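(* Let $T\ge 1$ and let $\varepsilon\in(0,1)$ be a fixed early stopping parameter. Let also $\eta\in(0,1)$ and $q\ge 2$. Let Assumptions 1, 2, 3 and 4 (stated in the context) hold for the $K$-component Gaussian mixture $P_{\mathrm{data}}$ on $\mathbb{R}^D$. Then there exists $D^\dagger=D^\dagger(\eta,q,\varepsilon)$ such that for any integer $D\ge D^\dagger$, $$\mathbb{P}\Bigl(\bigcap_{i\in[K]}\Bigl\{W_D^{[i]}(t,\overleftarrow{X}_t)\le\exp\bigl(-\eta\,\mathrm{KL}(\overrightarrow{p}^{[j]}_{T-t}\,\|\,\overrightarrow{p}^{[i]}_{T-t})\bigr)\Bigr\}\;\Big|\;\overleftarrow{X}_T\sim P^{[j]}_{\mathrm{data}}\Bigr)\ge 1-D^{-q},\qquad j\in[K],$$ for each $$t\in\Bigl[\max\bigl\{0,\;T+\tfrac12\log\tfrac{\underline{S}}{1+\underline{S}}\bigr\},\;T-\varepsilon\Bigr],$$ equivalently $\mathrm{SNR}_{T-t}\in\bigl[\max\{\mathrm{SNR}_T,\underline{S}\},\,\mathrm{SNR}_\varepsilon\bigr]$, where $\underline{S}\equiv\underline{S}(D,q,\eta)$ satisfies $$\underline{S}=\Theta\Bigl(\tfrac{\log(KD)}{D}\Bigr).$$ Besides, for any $\beta\in(0,1)$, $$\mathbb{P}\Bigl(\bigcap_{i\in[K],\,i\ne j}\bigl\{W_D^{[i]}(t,\overleftarrow{X}_t)\le\beta\bigr\}\;\Big|\;\overleftarrow{X}_T\sim P^{[j]}_{\mathrm{data}}\Bigr)\ge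 1-D^{-q},\qquad j\in[K],$$ whenever the reverse time $t$ satisfies $$\mathrm{SNR}_{T-t}\ge L\cdot\frac{\max\{\log(KD),\,\log\frac1\beta\}}{D}$$ for some constant $L>0$ independent of $D$.
   Context: Notation: $[K]=\{1,\dots,K\}$; $\|\cdot\|_2$ is the spectral norm; $\lambda_k(A)$ is the $k$-th largest eigenvalue of $A$; $\mathrm{KL}$ is Kullback–Leibler divergence. $f=\Theta(g)$ means $c_1 g\le f\le c_2 g$ for constants $0<c_1\le c_2<\infty$. For $t\ge 0$: $m_t=e^{-t}$, $\sigma_t=\sqrt{1-m_t^2}$, and $\mathrm{SNR}_t=m_t^2/\sigma_t^2$ for $t>0$. Model. $P_{\mathrm{data}}=\sum_{k=1}^K\pi_k\,\mathcal{N}(\mu_k,\Sigma_k)$ on $\mathbb{R}^D$, where $K\ge 2$, the $\pi_k$ are prior weights with $\sum_k\pi_k=1$, $\mu_k\in\mathbb{R}^D$, and $\Sigma_k\in\mathbb{R}^{D\times D}$ is positive semidefinite (Gaussian measures may be degenerate); $P^{[k]}_{\mathrm{data}}=\mathcal{N}(\mu_k,\Sigma_k)$. The forward process solves $d\overrightarrow{X}_t=-\overrightarrow{X}_t\,dt+\sqrt2\,dB_t$, $\overrightarrow{X}_0\sim P_{\mathrm{data}}$, $t\in[0,T]$, with $B$ a standard $D$-dimensional Brownian motion; for $t>0$, $\overrightarrow{p}_t$ is the density of $\overrightarrow{X}_t$ and $\overrightarrow{p}_t^{[k]}$ is the density (and also the law) of $\overrightarrow{X}_t$ given that $\overrightarrow{X}_0$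 belongs to cluster $k$, i.e. of $\mathcal{N}(m_t\mu_k,\,m_t^2\Sigma_k+\sigma_t^2I_D)$. The reverse process solves $d\overleftarrow{X}_t=(\overleftarrow{X}_t+2\nabla\log\overrightarrow{p}_{T-t}(\overleftarrow{X}_t))dt+\sqrt2\,dB_t$ with $\overleftarrow{X}_0\sim\mathrm{Law}(\overrightarrow{X}_T)$, so that $\mathrm{Law}(\overleftarrow{X}_t)=\mathrm{Law}(\overrightarrow{X}_{T-t})$. Conditioning on $\overleftarrow{X}_T\sim P^{[j]}_{\mathrm{data}}$ means conditioning on the terminal (data) point being drawn from mixture component $j$; under this conditioning $\overleftarrow{X}_t\sim\mathcal{N}(m_{T-t}\mu_j,\,m_{T-t}^2\Sigma_j+\sigma_{T-t}^2I_D)$. The posterior weights are, for $t\in[0,T)$ and $x\in\mathbb{R}^D$, $$W_D^{[k]}(t,x)=\frac{\pi_k\,\overrightarrow{p}^{[k]}_{T-t}(x)}{\sum_{\ell=1}^K\pi_\ell\,\overrightarrow{p}^{[\ell]}_{T-t}(x)}.$$ Assumption 1: there exists a constant $C_1\ge 0$ such that $\max_{i,j\in[K]}\log(\pi_i/\pi_j)\le C_1$. Assumption 2: (i) $\Sigma_i$ is symmetric positive semidefinite for any $i\in[K]$, and there exist a constant $C_2>0$ and $\alpha\in[0,1)$ such that for all $D\in\mathbb{N}$, $\max_{i\in[K]}\|\Sigma_i\|_2\le C_2D^\alpha$; (ii) for each $i\in[K]$ there exist a positive fixed integer $M_i<D$ and $\nu_i\ge 0$ such that for all $D\in\mathbb{N}$,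 $\sum_{k=M_i+1}^D\lambda_k(\Sigma_i)\le\nu_i$ and $\nu_i/M_i\le R$ for some universal constant $R\in[0,1)$. Assumption 3: for any two distinct clusters $i,j\in[K]$, there exist constants $C_3,C_4>0$ such that for all $D\in\mathbb{N}$, $C_3D\le\|\mu_i-\mu_j\|^2\le C_4D$. Assumption 4: there exists a constant $C_5>0$ such that for all $i,j\in[K]$, $\max_{k\in[D]}|\langle\mu_i-\mu_j,u_k(j)\rangle|\le C_5$, where $u_k(j)$ is the eigenvector associated with the eigenvalue $\lambda_k(\Sigma_j)$ (the $u_k(j)$, $k\in[D]$, forming an orthonormal basis).
   Formalization: In the ''Besides'' part the reverse time is also required to satisfy 0 ≤ t ≤ T−ε (early stopping); without it the claim fails as t→T, since SNR diverges and β may tend to 0 at fixed D while the posterior weights stay positive. *)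

(* Defs.v *)
From HB Require Import structures.
From mathcomp Require Import all_boot all_order all_algebra.
From mathcomp Require Import all_classical all_reals all_analysis.

Set Implicit Arguments.
Unset Strict Implicit.
Unset Printing Implicit Defensive.

Import Order.TTheory GRing.Theory Num.Theory.
Import numFieldNormedType.Exports.

Local Open Scope classical_set_scope.
Local Open Scope ring_scope.

Section borel_matrix.
Context {R : realType} {m n : nat}.

(* The Borel sigma-algebra of R^(m x n), generated by the entries. *)
Definition mx_cylinders : set (set 'M[R]_(m, n)) :=
  [set B | exists i j (A : set R),
     measurable A /\ B = (fun M : 'M[R]_(m, n) => M i j) @^-1` A].

Let mx_set0 : <<s mx_cylinders >> set0.
Proof. exact: sigma_algebra0. Qed.

Let mx_setC A : <<s mx_cylinders >> A -> <<s mx_cylinders >> (~` A).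
Proof. by move=> sA; rewrite -setTD; exact: sigma_algebraCD. Qed.

Let mx_bigcup (F : _^nat) : (forall i, <<s mx_cylinders >> (F i)) ->
  <<s mx_cylinders >> (\bigcup_i (F i)).
Proof. exact: sigma_algebra_bigcup. Qed.

HB.instance Definition _ := @isMeasurable.Build (sigma_display mx_cylinders)
  'M[R]_(m, n) <<s mx_cylinders >> mx_set0 mx_setC mx_bigcup.

End borel_matrix.

Section linear_algebra.
Context {R : realType} {n : nat}.
Implicit Types (x y : 'cV[R]_n) (A S : 'M[R]_n).

Definition dotp x y : R := (x^T *m y) 0 0.

Definition enorm x : R := Num.sqrt (dotp x x).

Definition spectral_norm A : R :=
  sup [set enorm (A *m x) | x in [set x | enorm x <= 1]].

Definition psd S : Prop := S^T = S /\ forall x, 0 <= dotp x (S *m x).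

(* Eigenvalues with algebraic multiplicity, in nonincreasing order; the list
   is empty when the characteristic polynomial does not split over R, which
   does not happen for a symmetric matrix. *)
Definition spectrum A : seq R :=
  sort (fun a b => b <= a)
    (xget [::] [set s : seq R | char_poly A = \prod_(a <- s) ('X - a%:P)]).

(* Numbered from 0: the k-th largest eigenvalue is eigval A k.-1. *)
Definition eigval A (k : nat) : R := nth 0 (spectrum A) k.

Definition orthonormal_eigenbasis A (u : 'I_n -> 'cV[R]_n) : Prop :=
  (forall k l, dotp (u k) (u l) = (k == l)%:R) /\
  (forall k, A *m u k = eigval A k *: u k).

End linear_algebra.

Section gaussian.
Context {R : realType}.

(* The law of n independent N(0,1) variables. *)
Fixpoint std_gaussian (n : nat) : set (n.-tuple R) -> \bar R :=
  match n return set (n.-tuple R) -> \bar R with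
  | 0 => \d_[tuple]
  | n'.+1 => pushforward (product_measure1 (@normal_prob R 0 1)
                                           (@std_gaussian n'))
               (fun z : R * n'.-tuple R => [tuple of z.1 :: z.2])
  end.

(* A square root B of S, that is, B *m B^T = S; it exists when S is positive
   semidefinite, and the law below does not depend on the choice of B. *)
Definition mx_root n (S : 'M[R]_n) : 'M[R]_n :=
  xget 0 [set B | B *m B^T = S].

(* N(mu, S) is the law of mu + B Z, where B B^T = S and Z is standard normal;
   S may be singular. *)
Definition gaussian n (mu : 'cV[R]_n) (S : 'M[R]_n) : set 'cV[R]_n -> \bar R :=
  pushforward (std_gaussian (n := n))
    (fun z : n.-tuple R => mu + mx_root S *m (\col_k tnth z k)).

(* The Lebesgue density of N(mu, S), for S positive definite. *)
Definition gaussian_pdf n (mu : 'cV[R]_n) (S : 'M[R]_n) (x : 'cV[R]_n) : R :=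
  (Num.sqrt ((pi *+ 2) ^+ n * \det S))^-1 *
  expR (- (dotp (x - mu) (invmx S *m (x - mu)) / 2)).

End gaussian.

(* The divergence from Q to P, where P and Q have densities p and q with
   respect to a common reference measure: the P-mean of log (p / q). *)
Definition KL {R : realType} {d} {T : measurableType d}
    (P : set T -> \bar R) (p q : T -> R) : \bar R :=
  (\int[P]_x (ln (p x / q x))%:E)%E.

Definition cond_prob {R : realType} {d} {T : measurableType d}
    (P : probability T R) (A B : set T) : R :=
  fine (P (A `&` B)) / fine (P B).

Section diffusion_model.
Context {R : realType}.

(* A mixture of K Gaussians on R^D. *)
Record gmm (K D : nat) := Gmm {
  weight : 'I_K -> R ;
  mean : 'I_K -> 'cV[R]_D ;
  cov : 'I_K -> 'M[R]_D ;
  weight_ge0 : forall k, 0 <= weight k ;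
  weight_sum : \sum_k weight k = 1 ;
  cov_psd : forall k, psd (cov k) }.

Definition scale_m (t : R) : R := expR (- t).

Definition scale_sigma (t : R) : R := Num.sqrt (1 - scale_m t ^+ 2).

Definition SNR (t : R) : R := scale_m t ^+ 2 / scale_sigma t ^+ 2.

Section one_mixture.
Context {K D : nat}.
Variable G : gmm K D.

Definition fwd_mean (t : R) (k : 'I_K) : 'cV[R]_D := scale_m t *: mean G k.

Definition fwd_cov (t : R) (k : 'I_K) : 'M[R]_D :=
  scale_m t ^+ 2 *: cov G k + (scale_sigma t ^+ 2)%:M.

(* Law and, for t > 0, density of the forward process at time t given that it
   starts in cluster k. *)
Definition fwd_law (t : R) (k : 'I_K) : set 'cV[R]_D -> \bar R :=
  gaussian (fwd_mean t k) (fwd_cov t k).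

Definition fwd_pdf (t : R) (k : 'I_K) : 'cV[R]_D -> R :=
  gaussian_pdf (fwd_mean t k) (fwd_cov t k).

Definition KL_fwd (t : R) (j i : 'I_K) : \bar R :=
  KL (fwd_law t j) (fwd_pdf t j) (fwd_pdf t i).

Definition post_weight (T t : R) (k : 'I_K) (x : 'cV[R]_D) : R :=
  weight G k * fwd_pdf (T - t) k x /
  \sum_l weight G l * fwd_pdf (T - t) l x.

(* The reverse process on [0, T], together with the mixture component from
   which its terminal point is drawn. Only the laws at fixed times are
   recorded, not the stochastic differential equation: given that the terminal
   point is drawn from component j, the process at time t has the law of the
   forward process at time T - t started in cluster j, which is N(mu_j, Sigma_j)
   for t = T. *)
Record reverse_process (T : R) d (Omega : measurableType d)
    (P : probability Omega R) := ReverseProcess {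
  label : Omega -> 'I_K ;
  rev_state : R -> Omega -> 'cV[R]_D ;
  label_measurable : forall j, measurable [set w | label w = j] ;
  rev_measurable : forall t, 0 <= t <= T -> measurable_fun setT (rev_state t) ;
  label_law : forall j, P [set w | label w = j] = (weight G j)%:E ;
  rev_law : forall t j (A : set 'cV[R]_D), 0 <= t <= T -> measurable A ->
    P (rev_state t @^-1` A `&` [set w | label w = j]) =
      ((weight G j)%:E * fwd_law (T - t) j A)%E }.

End one_mixture.

(* One mixture in each dimension, with a common number K of components. The
   constants in the four assumptions do not depend on the dimension. *)
Section assumptions.
Context {K : nat}.
Variable G : forall D, gmm K D.

(* Positivity of the weights is what makes the logarithms finite: ln is 0 on
   nonpositive reals. *)
Definition assumption1 : Prop :=
  exists2 C1 : R, 0 <= C1 & forall D, (0 < D)%N -> forall i j : 'I_K,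
    [/\ 0 < weight (G D) i, 0 < weight (G D) j &
        ln (weight (G D) i / weight (G D) j) <= C1].

(* That every covariance is positive semidefinite is part of gmm. *)
Definition assumption2_norm : Prop :=
  exists C2 alpha : R, [/\ 0 < C2, 0 <= alpha < 1 &
    forall D, (0 < D)%N -> forall i : 'I_K,
      spectral_norm (cov (G D) i) <= C2 * (D%:R `^ alpha)].

Definition assumption2_trace : Prop :=
  exists2 r : R, 0 <= r < 1 & forall i : 'I_K, exists (M : nat) (nu : R),
    [/\ (0 < M)%N, 0 <= nu, nu / M%:R <= r &
        forall D, (M < D)%N ->
          \sum_(M <= k < D) eigval (cov (G D) i) k <= nu].

Definition assumption2 : Prop := assumption2_norm /\ assumption2_trace.

Definition assumption3 : Prop :=
  forall i j : 'I_K, i != j -> exists C3 C4 : R, [/\ 0 < C3, 0 < C4 &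
    forall D, (0 < D)%N ->
      C3 * D%:R <= enorm (mean (G D) i - mean (G D) j) ^+ 2 <= C4 * D%:R].

Definition assumption4 : Prop :=
  exists2 C5 : R, 0 < C5 & forall D, (0 < D)%N -> forall j : 'I_K,
    exists2 u : 'I_D -> 'cV[R]_D, orthonormal_eigenbasis (cov (G D) j) u &
      forall (i : 'I_K) (k : 'I_D),
        `|dotp (mean (G D) i - mean (G D) j) (u k)| <= C5.

End assumptions.

(* f = Theta(g), uniformly over all positive integers. *)
Definition Theta (f g : nat -> R) : Prop :=
  exists c1 c2 : R, [/\ 0 < c1, c1 <= c2 &
    forall D, (0 < D)%N -> c1 * g D <= f D <= c2 * g D].

End diffusion_model.

(* Main.v *)
(** Put [s = T - t]. Given the label [j], the reverse process at time [t] has law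
    [P_j = N(m mu_j, A_j)] with [A_j = m^2 Sigma_j + sigma^2 I], and
    [W_i <= (pi_i / pi_j) exp(- Lambda_i)], where [Lambda_i = ln (p_j / p_i)] has
    [P_j]-mean [KL_i]. Chernoff's bound reduces the claim to an estimate of
    [E_j exp(- l Lambda_i)]. Writing [A_j = B B^T] and [Q = B^T A_i^-1 B], both this
    Laplace transform and [KL_i] are explicit in the eigenvalues of [Q], and comparing
    them eigenvalue by eigenvalue gives [E_j exp(- l Lambda_i) <= exp(- e l KL_i)]
    as soon as [e (1 - l + l q) <= 1 - l] for every eigenvalue [q]. Since
    [q <= 1 + SNR C_2 D^alpha], one may take [l] of order [1 / (1 + SNR D^alpha)].
    Finally [KL_i >= c SNR D]: in the eigenbasis of [Sigma_i] each coordinate of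
    [mu_j - mu_i] is bounded, and only finitely many eigenvalues exceed
    [1 / SNR_eps]. Hence [l KL_i] is at least of order [min (SNR D, D^(1 - alpha))],
    which dominates [q ln (K D)] once [SNR >= L ln (K D) / D] and [D] is large. *)

Require Import Defs.
From HB Require Import structures.
From mathcomp Require Import all_boot all_order all_algebra.
From mathcomp Require complex.
From mathcomp Require Import all_classical all_reals all_analysis.
From mathcomp Require Import measurable_realfun ring lra.

Set Implicit Arguments.
Unset Strict Implicit.
Unset Printing Implicit Defensive.

Import Order.TTheory GRing.Theory Num.Theory.
Import numFieldNormedType.Exports.
Local Open Scope classical_set_scope.
Local Open Scope ring_scope.

(** * The spectral theorem for real symmetric matrices *)

(** [S] and [L] are chosen before [eps], so the constant [c] in [KL_i >= c SNR D] must not depend on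
    [eps]. This is possible because [eps] only decides how many eigendirections are given up: their
    number stays bounded as [D] grows, so [eps] enters through the threshold on [D] alone. The
    margin [1 - eta] pays for every loss. With [tau = (1 - eta) / 2], one half is spent on
    [e = 1 - tau < 1], which leaves room for a positive [l]; the other half, a term [l tau KL_i] in
    the exponent, has to outweigh the ratio of the weights, the union over the clusters and
    [q ln D]. Exponential integrals are evaluated by induction on the dimension, because the
    standard law is an iterated product: completing the square in one coordinate leaves a form of
    the same kind whose matrix is a Schur complement, and the determinant factors accordingly. *)

Section dotp_theory.
Context {R : realType} {n : nat}.
Implicit Types (x y z : 'cV[R]_n) (A : 'M[R]_n).

Lemma dotpE x y : dotp x y = \sum_k x k 0 * y k 0.
Proof. by rewrite /dotp mxE; apply: eq_bigr => k _; rewrite mxE. Qed.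

Lemma dotpC x y : dotp x y = dotp y x.
Proof. by rewrite !dotpE; apply: eq_bigr => k _; rewrite mulrC. Qed.

Lemma dotpDl x y z : dotp (x + y) z = dotp x z + dotp y z.
Proof. by rewrite /dotp linearD mulmxDl mxE. Qed.

Lemma dotpDr x y z : dotp x (y + z) = dotp x y + dotp x z.
Proof. by rewrite /dotp mulmxDr mxE. Qed.

Lemma dotpZl a x y : dotp (a *: x) y = a * dotp x y.
Proof. by rewrite /dotp linearZ /= -scalemxAl mxE. Qed.

Lemma dotpZr a x y : dotp x (a *: y) = a * dotp x y.
Proof. by rewrite /dotp -scalemxAr mxE. Qed.

Lemma dotpNl x y : dotp (- x) y = - dotp x y.
Proof. by rewrite -scaleN1r dotpZl mulN1r. Qed.

Lemma dotpNr x y : dotp x (- y) = - dotp x y.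
Proof. by rewrite dotpC dotpNl dotpC. Qed.

Lemma dotp_ge0 x : 0 <= dotp x x.
Proof. by rewrite dotpE sumr_ge0// => k _; rewrite -expr2 sqr_ge0. Qed.

Lemma dotp_eq0 x : (dotp x x == 0) = (x == 0).
Proof.
apply/idP/eqP => [|->]; last by rewrite dotpE big1// => k _; rewrite mxE mul0r.
rewrite dotpE psumr_eq0 => [/allP h|k _]; last by rewrite -expr2 sqr_ge0.
apply/matrixP => i j; rewrite ord1 mxE; apply/eqP.
by have := h i (mem_index_enum _); rewrite -expr2 sqrf_eq0.
Qed.

Lemma dotp_gt0 x : x != 0 -> 0 < dotp x x.
Proof. by move=> x0; rewrite lt0r dotp_eq0 x0 dotp_ge0. Qed.

Lemma enorm_sqr x : enorm x ^+ 2 = dotp x x.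
Proof. by rewrite sqr_sqrtr// dotp_ge0. Qed.

End dotp_theory.

Lemma dotp_mulmx {R : realType} m n (A : 'M[R]_(m, n)) (x : 'cV_m) (y : 'cV_n) :
  dotp x (A *m y) = dotp (A^T *m x) y.
Proof. by rewrite /dotp trmx_mul trmxK mulmxA. Qed.

Lemma dotp_CauchySchwarz {R : realType} n (x y : 'cV[R]_n) :
  dotp x y ^+ 2 <= dotp x x * dotp y y.
Proof.
have [->|y0] := eqVneq y 0.
  by rewrite -(scale0r 0) !dotpZr !mul0r mulr0 expr0n.
have yy := dotp_gt0 y0.
have := dotp_ge0 (dotp y y *: x - dotp x y *: y).
rewrite dotpDr -scaleNr !dotpDl !dotpZr !dotpZl (dotpC y x) => h.
rewrite -subr_ge0 -(pmulr_rge0 _ yy); nra.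
Qed.

Definition posdef {R : realType} n (A : 'M[R]_n) : Prop :=
  A^T = A /\ forall x, x != 0 -> 0 < dotp x (A *m x).

Section spectral_theorem.
Import complex.
Context {R : realType}.

(** Over the complex numbers [A] is hermitian, hence unitarily diagonalizable with real diagonal. An
    eigenvalue found there is real and is a root of a characteristic polynomial with coefficients in
    [R], so it has an eigenvector over [R] as well. *)
Lemma symmetric_eigenvector n (A : 'M[R]_n.+1) : A^T = A ->
  exists2 x : 'cV_n.+1, x != 0 & exists a, A *m x = a *: x.
Proof.
move=> sA; pose toC := @complex.real_complex_def R (Phant R).
pose B : 'M[complex.complex R]_n.+1 := map_mx toC A.
have hB : B \is hermsymmx.
  apply: realsym_hermsym.
    by apply/is_hermitianmxP; rewrite expr0 scale1r map_mx_id// map_trmx sA.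
  by apply/mxOverP => i j; rewrite mxE complex_real.
have /orthomx_spectralP BE := hermitian_normalmx hB.
have /complex_realP[a sa] := mxOverP (hermitian_spectral_diag_real hB) 0 0.
have : eigenvalue B (toC a).
  apply/eigenvalueP; exists (row 0 (spectralmx B)); last first.
    apply: contraTneq (spectral_unit B) => r0; rewrite -row_free_unit.
    by apply/row_freePn; exists 0; rewrite r0 sub0mx.
  rewrite -row_mul {2}BE !mulmxA mulmxV ?spectral_unit// mul1mx row_mul.
  by rewrite row_diag_mx -scalemxAl -rowE sa.
rewrite eigenvalue_root_char -map_char_poly fmorph_root -eigenvalue_root_char.
move=> /eigenvalueP[v vA v0]; exists v^T.
  by rewrite -(inj_eq (can_inj (@trmxK _ _ _))) trmxK trmx0.
by exists a; rewrite -[in LHS]sA -trmx_mul vA linearZ.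
Qed.

(** The Householder reflection in the hyperplane orthogonal to [w]; it is the identity for
    [w = 0]. *)
Definition reflection n (w : 'cV[R]_n) : 'M[R]_n :=
  1%:M - (2 / dotp w w) *: (w *m w^T).

Lemma reflectionT n (w : 'cV[R]_n) : (reflection w)^T = reflection w.
Proof. by rewrite linearB linearZ /= trmx1 trmx_mul trmxK. Qed.

Lemma mulmx_tr_dotp n (x y z : 'cV[R]_n) : x *m y^T *m z = dotp y z *: x.
Proof. by rewrite -mulmxA [y^T *m z]mx11_scalar mul_mx_scalar. Qed.

Lemma reflection_mulmx n (w x : 'cV[R]_n) :
  reflection w *m x = x - (2 * dotp w x / dotp w w) *: w.
Proof.
by rewrite mulmxBl mul1mx -scalemxAl mulmx_tr_dotp scalerA mulrAC.
Qed.

Lemma reflectionK n (w : 'cV[R]_n) : reflection w *m reflection w = 1%:M.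
Proof.
have [->|w0] := eqVneq w 0.
  by rewrite /reflection mul0mx scaler0 subr0 mulmx1.
have ww : dotp w w != 0 by rewrite dotp_eq0.
rewrite {2}/reflection mulmxBr mulmx1 -scalemxAr mulmxA reflection_mulmx.
rewrite -mulrA divff// mulr1 mulmxBl -scalemxAl scaler_nat mulr2n opprD addrA.
by rewrite addrAC subrr add0r scalerN opprK /reflection addrK.
Qed.

(** The reflection along [x - y] exchanges two vectors of equal length, since then
    [2 <x - y, x> = |x - y|^2]. *)
Lemma exists_reflection n (x y : 'cV[R]_n) : dotp x x = dotp y y ->
  exists H : 'M[R]_n, [/\ H^T = H, H *m H = 1%:M & H *m x = y].
Proof.
move=> xy; exists (reflection (x - y)); split.
- exact: reflectionT.
- exact: reflectionK.
have [->|ne] := eqVneq x y.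
  by rewrite subrr reflection_mulmx scaler0 subr0.
have w0 : dotp (x - y) (x - y) != 0 by rewrite dotp_eq0 subr_eq0.
rewrite reflection_mulmx (_ : 2 * _ / _ = 1) ?scale1r ?subKr//.
apply/eqP; rewrite -(inj_eq (mulIf w0)) divfK// mul1r; apply/eqP.
by rewrite !dotpDl !dotpDr !dotpNl !dotpNr (dotpC y x) -xy; ring.
Qed.

(** Deflation: a reflection [H] sends a unit eigenvector to the first basis vector, so the first
    column of [H A H] is a multiple of that vector. By symmetry [H A H] is then block diagonal, and
    the induction hypothesis treats the lower block. *)
Lemma spectral_theorem n (A : 'M[R]_n) : A^T = A ->
  exists (U : 'M[R]_n) (d : 'rV[R]_n),
    U^T *m U = 1%:M /\ A = U *m diag_mx d *m U^T.
Proof.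
elim: n A => [|n IH] A sA.
  by exists 1%:M, 0; split; apply/matrixP => -[].
have [x x0 [a Ax]] := symmetric_eigenvector sA.
pose e : 'cV[R]_n.+1 := delta_mx 0 0.
have ee : dotp e e = 1.
  rewrite dotpE (bigD1 0)//= big1 ?mxE ?eqxx ?mulr1 ?addr0// => k k0.
  by rewrite mxE (negbTE k0) mul0r.
pose u := (enorm x)^-1 *: x.
have nx : enorm x != 0.
  by apply: contraNneq x0 => h; rewrite -dotp_eq0 -enorm_sqr h expr0n.
have Au : A *m u = a *: u by rewrite -scalemxAr Ax scalerA mulrC -scalerA.
have uu : dotp u u = dotp e e.
  by rewrite ee dotpZl dotpZr -enorm_sqr expr2 mulKf// mulVf.
have [H [HT HH Hu]] := exists_reflection uu.
pose B : 'M[R]_(1 + n) := H *m A *m H.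
have sB : B^T = B by rewrite !trmx_mul HT sA mulmxA.
have Be : B *m e = a *: e.
  by rewrite -Hu /B -!mulmxA (mulmxA H H) HH mul1mx Au -scalemxAr.
have AE : A = H *m B *m H.
  by rewrite /B !mulmxA HH mul1mx -mulmxA HH mulmx1.
clearbody B.
have Bi0 i : B i 0 = a * (i == 0)%:R.
  by have /colP/(_ i) := Be; rewrite -colE !mxE andbT.
pose C := drsubmx B.
have BE : B = block_mx a%:M 0 0 C.
  rewrite -[LHS]submxK; congr block_mx.
  - apply/matrixP => i j; rewrite !ord1 !mxE eqxx mulr1n.
    rewrite (_ : lshift n 0 = 0) ?Bi0 ?eqxx ?mulr1//; exact: val_inj.
  - apply/matrixP => i j; rewrite ord1 !mxE.
    rewrite -sB mxE (_ : lshift n 0 = 0) ?Bi0 ?mulr0//; last exact: val_inj.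
  - apply/matrixP => i j; rewrite ord1 !mxE.
    rewrite (_ : lshift n 0 = 0) ?Bi0 ?mulr0//; last exact: val_inj.
have sC : C^T = C by rewrite /C trmx_drsub sB.
have [U [d [UU CE]]] := IH C sC.
pose V : 'M[R]_(1 + n) := block_mx 1%:M 0 0 U.
pose dd : 'rV[R]_(1 + n) := row_mx a%:M d.
have VV : V^T *m V = 1%:M.
  rewrite /V tr_block_mx trmx1 !trmx0 mulmx_block !mulmx0 !mul0mx !mulmx1.
  by rewrite !addr0 add0r UU -scalar_mx_block.
have BV : B = V *m diag_mx dd *m V^T.
  rewrite BE CE /V tr_block_mx trmx1 !trmx0 diag_mx_row !mulmx_block.
  rewrite !mulmx0 !mul0mx !mulmx1 !mul1mx !addr0 !add0r ?mul0mx ?mulmx0.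
  by congr block_mx; apply/matrixP => i j; rewrite !ord1 !mxE eqxx.
exists (H *m V), dd; split.
  by rewrite trmx_mul HT -mulmxA (mulmxA H H) HH mul1mx VV.
by rewrite AE BV trmx_mul HT !mulmxA.
Qed.

End spectral_theorem.

(** * Integrals against N(0, 1) *)

Ltac measurable_poly := repeat
  first [ by [] | apply: measurable_funB | apply: measurable_funD
        | apply: measurable_funM | apply: measurable_funX ].

Section normal_integral.
Context {R : realType}.
Local Notation N01 := (@normal_prob R 0 1).
Local Notation mu := (@lebesgue_measure R).

(** The Radon-Nikodym derivative of the law agrees almost everywhere with [normal_pdf], as both have
    the same integral over every measurable set. *)
Lemma ge0_integral_normal_prob (f : R -> \bar R) :
  measurable_fun setT f -> (forall x, 0 <= f x)%E ->
  (\int[N01]_x f x = \int[mu]_x (f x * (normal_pdf 0 1 x)%:E))%E.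
Proof.
move=> mf f0.
have dom : N01 `<< mu := normal_prob_dominates 0 1.
rewrite -(Radon_Nikodym_SigmaFinite.change_of_variables dom)//.
apply: ae_eq_integral => //.
- apply: emeasurable_funM => //.
  exact: measurable_int (Radon_Nikodym_SigmaFinite.f_integrable dom).
- apply: emeasurable_funM => //; apply/measurable_EFinP.
  exact: measurable_normal_pdf.
- apply: ae_eqe_mul2l; apply: integral_ae_eq => //.
  + exact: (Radon_Nikodym_SigmaFinite.f_integrable dom).
  + by apply/measurable_EFinP; exact: measurable_normal_pdf.
  + by move=> E _ mE; rewrite -Radon_Nikodym_SigmaFinite.f_integral.
Qed.

(** The term [x^2 / 2] cancels the exponent of the standard density, and what is left is [a^(-1/2)]
    times the density of N(- c, 1/a). *)
Lemma normal_exp_quadratic (a c : R) : 0 < a ->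
  (\int[N01]_x (expR (x ^+ 2 / 2 - a * (x + c) ^+ 2 / 2))%:E
   = ((Num.sqrt a)^-1)%:E)%E.
Proof.
move=> a0; have sa0 : Num.sqrt a != 0 by rewrite gt_eqF ?sqrtr_gt0.
have sV0 : (Num.sqrt a)^-1 != 0 :> R by rewrite invr_eq0.
rewrite ge0_integral_normal_prob//; last first.
- apply/measurable_EFinP; apply: measurableT_comp => //.
  by measurable_poly.
transitivity (\int[mu]_x ((Num.sqrt a)^-1%:E *
    (normal_pdf (- c) (Num.sqrt a)^-1 x)%:E))%E; last first.
  rewrite ge0_integralZl//.
  - by rewrite integral_normal_pdf mule1.
  - by apply/measurable_EFinP; exact: measurable_normal_pdf.
  - by move=> x _; rewrite lee_fin normal_pdf_ge0.
apply: eq_integral => x _; rewrite -!EFinM; congr EFin.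
rewrite !normal_pdfE ?oner_neq0// /normal_peak /normal_fun.
rewrite mulrCA -expRD expr1n mul1r exprVn sqr_sqrtr ?(ltW a0)//.
rewrite [RHS]mulrA -invfM; congr (_^-1 * expR _).
  rewrite -sqrtrM ?(ltW a0)//; congr Num.sqrt.
  by rewrite -mulrnAr mulrA mulfV ?mul1r ?gt_eqF.
rewrite subr0 opprK -[a^-1 *+ 2]mulr_natr invfM invrK.
by field.
Qed.

Lemma measurable_sqr : measurable_fun setT (fun x : R => (x ^+ 2)%:E).
Proof. exact/measurable_EFinP/measurable_funX. Qed.

Lemma normal_exp_sqr (h : R) : h < 2^-1 ->
  (\int[N01]_x (expR (h * x ^+ 2))%:E = ((Num.sqrt (1 - 2 * h))^-1)%:E)%E.
Proof.
move=> h2; rewrite -(@normal_exp_quadratic _ 0); last by lra.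
by apply: eq_integral => x _; congr (expR _)%:E; rewrite addr0; field.
Qed.

Lemma measurable_exp_sqr (h : R) :
  measurable_fun setT (fun x : R => (expR (h * x ^+ 2))%:E).
Proof.
by apply/measurable_EFinP; apply: measurableT_comp => //; measurable_poly.
Qed.

Lemma normal_cst_expectation (c : \bar R) : (\int[N01]_x c = c)%E.
Proof. by rewrite integral_cst//= probability_setT mule1. Qed.

(* Integrate [1 + h x^2 <= exp (h x^2)], with [h] such that the right-hand side
   integrates to [1 + u]. *)
Lemma normal_sqr_le (u : R) : 0 < u ->
  (\int[N01]_x (x ^+ 2)%:E <= (2 * (1 + u) ^+ 2 / (2 + u))%:E)%E.
Proof.
move=> u0; have u1 : 0 < 1 + u by lra.
have u2 : 0 < 2 + u by lra.
pose h := u * (2 + u) / (2 * (1 + u) ^+ 2).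
have h0 : 0 < h by rewrite divr_gt0 ?mulr_gt0 ?exprn_gt0.
have hE : 1 - 2 * h = (1 + u) ^- 2 by rewrite /h; field; rewrite gt_eqF.
have h2 : h < 2^-1.
  have : 0 < 1 - 2 * h by rewrite hE invr_gt0 exprn_gt0.
  by lra.
have := normal_exp_sqr h2.
rewrite hE sqrtrV ?sqr_ge0// sqrtr_sqr gtr0_norm// invrK => int.
have : (1 + h%:E * \int[N01]_x (x ^+ 2)%:E <= (1 + u)%:E)%E.
  rewrite -int -ge0_integralZl//; last 3 first.
  - exact: measurable_sqr.
  - by move=> x _; rewrite lee_fin sqr_ge0.
  - by rewrite lee_fin ltW.
  rewrite -[X in (X + _ <= _)%E]normal_cst_expectation -ge0_integralD//.
  - apply: ge0_le_integral => //.
    + by move=> x _; rewrite -EFinM lee_fin addr_ge0// mulr_ge0 ?sqr_ge0// ltW.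
    + apply: emeasurable_funD => //; apply: emeasurable_funM => //.
      exact: measurable_sqr.
    + exact: measurable_exp_sqr.
    + by move=> x _; rewrite -EFinM lee_fin expR_ge1Dx.
  - by move=> x _; rewrite -EFinM lee_fin mulr_ge0 ?sqr_ge0// ltW.
  - by apply: emeasurable_funM => //; exact: measurable_sqr.
rewrite EFinD leeD2lE// -lee_pdivlMl// => /le_trans; apply.
rewrite -EFinM lee_fin le_eqVlt; apply/orP; left; apply/eqP.
by rewrite /h; field; rewrite !gt_eqF.
Qed.

(** Integrate [1 - h x^2 <= exp (- h x^2)], with [h] such that the right-hand side integrates to
    [1 - u]. *)
Lemma normal_sqr_ge (u : R) : 0 < u < 1 ->
  ((2 * (1 - u) ^+ 2 / (2 - u))%:E <= \int[N01]_x (x ^+ 2)%:E)%E.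
Proof.
move=> /andP[u0 ul1]; have u1 : 0 < 1 - u by lra.
have u2 : 0 < 2 - u by lra.
pose h := u * (2 - u) / (2 * (1 - u) ^+ 2).
have h0 : 0 < h by rewrite divr_gt0 ?mulr_gt0 ?exprn_gt0.
have hE : 1 - 2 * - h = (1 - u) ^- 2 by rewrite /h; field; rewrite gt_eqF.
have h2 : - h < 2^-1 by lra.
have := normal_exp_sqr h2.
rewrite hE sqrtrV ?sqr_ge0// sqrtr_sqr gtr0_norm// invrK => int.
have : (1 <= h%:E * \int[N01]_x (x ^+ 2)%:E + (1 - u)%:E)%E.
  rewrite -int -ge0_integralZl//; last 3 first.
  - exact: measurable_sqr.
  - by move=> x _; rewrite lee_fin sqr_ge0.
  - by rewrite lee_fin ltW.
  rewrite -[X in (X <= _)%E]normal_cst_expectation -ge0_integralD//.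
  - apply: ge0_le_integral => //.
    + apply: emeasurable_funD; last exact: measurable_exp_sqr.
      by apply: emeasurable_funM => //; exact: measurable_sqr.
    + move=> x _; rewrite -EFinM lee_fin -lerBlDl mulNr.
      exact: expR_ge1Dx.
  - by move=> x _; rewrite -EFinM lee_fin mulr_ge0 ?sqr_ge0// ltW.
  - by apply: emeasurable_funM => //; exact: measurable_sqr.
  - exact: measurable_exp_sqr.
rewrite -leeBlDr// -EFinB opprB addrCA subrr addr0 -lee_pdivrMl//.
apply: le_trans; rewrite -EFinM lee_fin le_eqVlt; apply/orP; left; apply/eqP.
by rewrite /h; field; rewrite !gt_eqF.
Qed.

(** The two preceding bounds tend to [1] with [u]. The limit is replaced by an explicit [u]: the
    upper bound is below [1 + 3 u] and the lower one above [1 - 3 u], which excludes any other value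
    of [m]. *)
Lemma normal_sqr_expectation : (\int[N01]_x (x ^+ 2)%:E = 1)%E.
Proof.
have fin : (\int[N01]_x (x ^+ 2)%:E \is a fin_num)%E.
  rewrite ge0_fin_numE; last by apply: integral_ge0 => x _; rewrite lee_fin sqr_ge0.
  by apply: le_lt_trans (normal_sqr_le ltr01) _; rewrite ltry.
rewrite -(fineK fin); congr EFin; set m := fine _.
have up u : 0 < u -> m <= 2 * (1 + u) ^+ 2 / (2 + u).
  by move=> u0; rewrite -lee_fin fineK// normal_sqr_le.
have lo u : 0 < u < 1 -> 2 * (1 - u) ^+ 2 / (2 - u) <= m.
  by move=> u0; rewrite -lee_fin fineK// normal_sqr_ge.
clearbody m; apply/eqP; rewrite eq_le; apply/andP; split.
  rewrite leNgt; apply/negP => m1.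
  pose u := Num.min ((m - 1) / 3) 1.
  have u0 : 0 < u by rewrite lt_min ltr01 divr_gt0// subr_gt0.
  have [u1 u3] : u <= 1 /\ u <= (m - 1) / 3 by rewrite ge_min lexx orbT ge_min lexx.
  have := up u u0; rewrite ler_pdivlMr; last by lra.
  nra.
rewrite leNgt; apply/negP => m1.
pose u := Num.min ((1 - m) / 3) (2^-1).
have u0 : 0 < u by rewrite lt_min invr_gt0 ltr0n divr_gt0// subr_gt0.
have [u1 u3] : u <= 2^-1 /\ u <= (1 - m) / 3.
  by rewrite ge_min lexx orbT ge_min lexx.
have u01 : 0 < u < 1 by apply/andP; split; lra.
have := lo u u01; rewrite ler_pdivrMr; last by lra.
nra.
Qed.

Lemma integrable_normal_sqr : N01.-integrable setT (fun x : R => (x ^+ 2)%:E).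
Proof.
apply/integrableP; split; first exact: measurable_sqr.
under eq_integral do rewrite gee0_abs ?lee_fin ?sqr_ge0//.
by rewrite normal_sqr_expectation ltry.
Qed.

Lemma integrable_normal_id : N01.-integrable setT (EFin : R -> \bar R).
Proof.
have int : N01.-integrable setT
    ((fun x : R => 1%:E) \+ (fun x : R => (x ^+ 2)%:E))%E.
  apply: integrableD => //; last exact: integrable_normal_sqr.
  exact: (finite_measure_integrable_cst _ 1).
apply: (le_integrable measurableT _ _ int); first exact/measurable_EFinP.
move=> x _; rewrite -EFinD lee_fin [leRHS]ger0_norm ?addr_ge0 ?sqr_ge0//.
by rewrite ler_norml; apply/andP; split; nra.
Qed.

(** Let [m] be the mean. Integrating [1 + y <= exp y] at [y = h x - h^2 / 2] gives
    [1 + h m <= exp (h^2 / 2)]. For small [h] with the sign of [m] the linear term would win, so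
    [m = 0]. *)
Lemma normal_expectation : (\int[N01]_x x%:E = 0)%E.
Proof.
have fin : (\int[N01]_x x%:E \is a fin_num)%E.
  exact: integrable_fin_num integrable_normal_id.
rewrite -(fineK fin); congr EFin; set m := fine _.
have up h : 1 + h * m <= expR (h ^+ 2 / 2).
  rewrite -lee_fin EFinD EFinM fineK// -integralZl//; last first.
    exact: integrable_normal_id.
  have := @normal_exp_quadratic 1 (- h) ltr01.
  rewrite sqrtr1 invr1.
  have mexp : measurable_fun setT
      (fun x : R => (expR (x ^+ 2 / 2 - 1 * (x - h) ^+ 2 / 2))%:E).
    by apply/measurable_EFinP; apply: measurableT_comp => //; measurable_poly.
  move=> int.
  have iexp : N01.-integrable setT
      (fun x : R => (expR (x ^+ 2 / 2 - 1 * (x - h) ^+ 2 / 2))%:E).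
    apply/integrableP; split=> //.
    under eq_integral do rewrite gee0_abs ?lee_fin ?expR_ge0//.
    by rewrite int ltry.
  rewrite -[X in (_ <= X)%E]mule1 -[X in (_ <= _ * X)%E]int -integralZl//.
  rewrite -[X in (X + _ <= _)%E]normal_cst_expectation -integralD//; last 2 first.
  - exact: (finite_measure_integrable_cst _ 1).
  - by apply: integrableZl => //; exact: integrable_normal_id.
  apply: le_integral => //.
  - apply: integrableD => //; first exact: (finite_measure_integrable_cst _ 1).
    by apply: integrableZl => //; exact: integrable_normal_id.
  - exact: integrableZl.
  move=> x _; rewrite -!EFinM -EFinD lee_fin -expRD.
  apply: le_trans (expR_ge1Dx _) _; rewrite ler_expR le_eqVlt; apply/orP; left.
  by apply/eqP; field.
(* For [h^2 <= 1] one has [exp (h^2 / 2) <= 1 + h^2], a consequence of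
   [1 - h^2 / 2 <= exp (- h^2 / 2)]. *)
have lo h : h ^+ 2 <= 1 -> h * m <= h ^+ 2.
  move=> h1; have := up h.
  have := @expR_ge1Dx _ (- (h ^+ 2 / 2)); have := @expR_gt0 _ (h ^+ 2 / 2).
  have := sqr_ge0 h; rewrite expRN.
  move: (expR _) => e h0 e0 e1 e2.
  have : (1 - h ^+ 2 / 2) * e <= 1 by rewrite -ler_pdivlMr// mul1r.
  have : e * (1 - h ^+ 2 / 2) <= (1 + h ^+ 2) * (1 - h ^+ 2 / 2) ->
      e <= 1 + h ^+ 2 by rewrite ler_pM2r//; lra.
  move: (h ^+ 2) h0 h1 {e1 up} e2 => y *; have : e <= 1 + y; [nra|lra].
have m1 := sqr_ge0 m.
(* With this [h], [h m = h^2 (1 + m^2)], so [h m <= h^2] leaves [h^2 m^2 <= 0]. *)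
pose h := m / (1 + m ^+ 2).
have hE : h * (1 + m ^+ 2) = m by rewrite divfK// gt_eqF; lra.
have h2 : h ^+ 2 <= 1.
  rewrite /h expr_div_n ler_pdivrMr ?mul1r; last by rewrite exprn_gt0//; lra.
  by clearbody m; have := sqr_ge0 (m ^+ 2); nra.
clearbody h m.
have hm : h * m <= h ^+ 2 by exact: lo.
have hm2 : h * m = h ^+ 2 * (1 + m ^+ 2) by rewrite -[in LHS]hE; ring.
have /eqP : (h * m) ^+ 2 = 0.
  by apply/eqP; rewrite eq_le sqr_ge0 andbT exprMn; nra.
rewrite sqrf_eq0 mulf_eq0 => /orP[/eqP h0|/eqP//].
by rewrite -hE h0 mul0r.
Qed.

End normal_integral.

(** * The standard Gaussian measure *)

Section std_gaussian_measure.
Context {R : realType}.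
Local Notation N01 := (@normal_prob R 0 1).

Lemma pushforward_probability d1 d2 (T1 : measurableType d1)
    (T2 : measurableType d2) (P : probability T1 R) (f : T1 -> T2) :
  measurable_fun setT f ->
  exists Q : probability T2 R, pushforward P f = Q :> (set T2 -> \bar R).
Proof.
move=> mf; pose X : {mfun T1 >-> T2} := HB.pack f (isMeasurableFun.Build _ _ _ _ f mf).
by exists (distribution P X).
Qed.

(* [normal_prob] lives on [measurableTypeR R], whose display differs from that of
   the tuple entries; [integrable] over the product does not see through this. *)
Definition tcons n (z : measurableTypeR R * n.-tuple R) : n.+1.-tuple R :=
  [tuple of z.1 :: z.2].

Lemma measurable_tcons n : measurable_fun setT (@tcons n).
Proof. exact: measurable_cons. Qed.

(** [std_gaussian] is a bare set function defined by recursion. Identifying it with a probability at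
    each stage lets the next product and pushforward be formed, and supplies the measure axioms for
    the instances below. *)
Lemma std_gaussian_probability n :
  exists P : probability (n.-tuple R) R,
    @std_gaussian R n = P :> (set (n.-tuple R) -> \bar R).
Proof.
elim: n => [|n [P IH]] /=; first by exists \d_[tuple].
have [Q QE] := pushforward_probability (N01 \x P)%E (@measurable_tcons n).
by exists Q; rewrite IH -QE.
Qed.

Section measure_instance.
Variable n : nat.

Let mu0 : @std_gaussian R n set0 = 0%E.
Proof. by have [P ->] := std_gaussian_probability n. Qed.

Let mu_ge0 A : (0 <= @std_gaussian R n A)%E.
Proof. by have [P ->] := std_gaussian_probability n. Qed.

Let mu_sigma_additive : semi_sigma_additive (@std_gaussian R n).
Proof.
have [P ->] := std_gaussian_probability n; exact: measure_semi_sigma_additive.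
Qed.

HB.instance Definition _ := isMeasure.Build _ _ _
  (@std_gaussian R n) mu0 mu_ge0 mu_sigma_additive.

Let mu_setT : @std_gaussian R n setT = 1%E.
Proof.
by have [P ->] := std_gaussian_probability n; rewrite probability_setT.
Qed.

HB.instance Definition _ := @Measure_isProbability.Build _ _ R
  (@std_gaussian R n) mu_setT.

End measure_instance.

Lemma ge0_integral_std_gaussianS n (f : n.+1.-tuple R -> \bar R) :
  measurable_fun setT f -> (forall z, 0 <= f z)%E ->
  (\int[std_gaussian (n := n.+1)]_z f z =
   \int[std_gaussian (n := n)]_z \int[N01]_x f (tcons (x, z)))%E.
Proof.
move=> mf f0; rewrite /= ge0_integral_pushforward//; last exact: measurable_tcons.
rewrite fubini_tonelli2//; last by move=> x; exact: f0.
by apply: measurableT_comp => //; exact: measurable_tcons.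
Qed.

(** Fubini for a product of a function of the first coordinate and a function of the others. The
    factors may change sign, so integrability is carried along with the value. *)
Lemma std_gaussianS_prod n (f : R -> R) (g : n.-tuple R -> R) :
  N01.-integrable setT (EFin \o f) ->
  (std_gaussian (n := n)).-integrable setT (EFin \o g) ->
  (std_gaussian (n := n.+1)).-integrable setT
     (fun z => (f (thead z) * g [tuple of behead z])%:E) /\
  (\int[std_gaussian (n := n.+1)]_z (f (thead z) * g [tuple of behead z])%:E =
   \int[N01]_x (f x)%:E * \int[std_gaussian (n := n)]_z (g z)%:E)%E.
Proof.
move=> If Ig; pose h (z : n.+1.-tuple R) := (f (thead z) * g [tuple of behead z])%:E.
have mf : measurable_fun setT f by apply/measurable_EFinP; exact: measurable_int If.
have mg : measurable_fun setT g by apply/measurable_EFinP; exact: measurable_int Ig.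
have mh : measurable_fun setT h.
  apply/measurable_EFinP/measurable_funM; apply: measurableT_comp => //.
    exact: measurable_tnth.
  exact: measurable_behead.
have hE x z : h (tcons (x, z)) = ((f x)%:E * (g z)%:E)%E.
  by rewrite /h /= theadE -EFinM; congr (f x * g _)%:E; apply: val_inj.
have fin (c : R -> \bar R) : N01.-integrable setT c ->
    exists2 k : R, 0 <= k & (\int[N01]_x `|c x|)%E = k%:E.
  move=> /integrableP[mc cy]; exists (fine (\int[N01]_x `|c x|)%E).
    by rewrite fine_ge0// integral_ge0.
  by rewrite fineK// ge0_fin_numE// integral_ge0.
have [k k0 kE] := fin _ If.
have Ih : (N01 \x std_gaussian (n := n))%E.-integrable setT (h \o @tcons n).
  apply/integrable21ltyP.
    by apply: measurableT_comp => //; exact: measurable_tcons.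
  rewrite (eq_integral (fun z => (k%:E * `|(g z)%:E|)%E)); last first.
    move=> z _; rewrite -kE -ge0_integralZr//; last first.
      by apply: measurableT_comp => //; exact/measurable_EFinP.
    by apply: eq_integral => x _; rewrite [(h \o _) _]hE abseM.
  rewrite ge0_integralZl//.
    by apply: lte_mul_pinfty => //; move/integrableP: Ig => [].
  by apply: measurableT_comp => //; exact/measurable_EFinP.
have Ih' := Ih; rewrite -(preimage_setT (@tcons n)) in Ih'.
split.
  exact: (integrable_pushforward (@measurable_tcons n) mh Ih' measurableT).
rewrite [LHS](integral_pushforward (@measurable_tcons n) mh Ih' measurableT).
rewrite preimage_setT -integral21_prod_meas1// /fubini_G.
rewrite (eq_integral (fun z => (fine (\int[N01]_x (f x)%:E) * g z)%:E)).
  under eq_integral do rewrite EFinM.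
  by rewrite integralZl// fineK//; exact: integrable_fin_num.
move=> z _; rewrite EFinM fineK ?(integrable_fin_num _ If)// -integralZr//.
by apply: eq_integral => x _; rewrite [(h \o _) _]hE.
Qed.

End std_gaussian_measure.

(** * Measurability of vector-valued maps, and block identities for [dotp] *)

Section vector_measurability.
Context {R : realType} d (T : measurableType d).

(** Measurability entry by entry, which is directly stable under the operations on vectors;
    [measurable_fun_cV] turns it into measurability for the Borel structure. *)
Definition measurable_cV n (V : T -> 'cV[R]_n) :=
  forall k, measurable_fun setT (fun t => V t k 0).

Lemma measurable_cV_cst n (w : 'cV[R]_n) : measurable_cV (fun=> w).
Proof. by move=> k; exact: measurable_cst. Qed.

Lemma measurable_cVD n (V W : T -> 'cV[R]_n) :
  measurable_cV V -> measurable_cV W -> measurable_cV (fun t => V t + W t).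
Proof.
move=> mV mW k; under eq_fun do rewrite mxE.
exact: measurable_funD.
Qed.

Lemma measurable_cVB n (V W : T -> 'cV[R]_n) :
  measurable_cV V -> measurable_cV W -> measurable_cV (fun t => V t - W t).
Proof.
move=> mV mW k; under eq_fun do rewrite !mxE.
exact: measurable_funB.
Qed.

Lemma measurable_cV_mulmx m n (A : 'M[R]_(m, n)) (V : T -> 'cV[R]_n) :
  measurable_cV V -> measurable_cV (fun t => A *m V t).
Proof.
move=> mV k; under eq_fun do rewrite mxE.
by apply: measurable_sum => i; apply: measurable_funM.
Qed.

Lemma measurable_dotp n (V W : T -> 'cV[R]_n) :
  measurable_cV V -> measurable_cV W ->
  measurable_fun setT (fun t => dotp (V t) (W t)).
Proof.
move=> mV mW; under eq_fun do rewrite dotpE.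
by apply: measurable_sum => i; apply: measurable_funM.
Qed.

End vector_measurability.

Lemma dotp_col_mx {R : realType} m n (u u' : 'cV[R]_m) (v v' : 'cV[R]_n) :
  dotp (col_mx u v) (col_mx u' v') = dotp u u' + dotp v v'.
Proof. by rewrite /dotp tr_col_mx mul_row_col mxE. Qed.

Lemma dotp_scalar {R : realType} (x y : R) :
  dotp (x%:M : 'cV_1) (y%:M : 'cV_1) = x * y.
Proof. by rewrite dotpE big_ord1 !mxE eqxx !mulr1n. Qed.

Lemma dotp0r {R : realType} n (x : 'cV[R]_n) : dotp x 0 = 0.
Proof. by rewrite -(scale0r x) dotpZr mul0r. Qed.

Lemma lshift0 m n : lshift n (0 : 'I_m.+1) = 0 :> 'I_(m.+1 + n).
Proof. exact: val_inj. Qed.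

Lemma dotp_col_mx1 {R : realType} n (b : 'cV[R]_(1 + n)) x (y : 'cV[R]_n) :
  dotp b (col_mx x%:M y) = b 0 0 * x + dotp (dsubmx b) y.
Proof.
rewrite -{1}[b]vsubmxK dotp_col_mx [usubmx b]mx11_scalar dotp_scalar.
by rewrite mxE lshift0.
Qed.

Lemma dotp_block1 {R : realType} n (M : 'M[R]_(1 + n)) x (y : 'cV[R]_n) :
  dotp (col_mx x%:M y) (M *m col_mx x%:M y) =
  x ^+ 2 * M 0 0 + x * dotp ((ursubmx M)^T + dlsubmx M) y +
  dotp y (drsubmx M *m y).
Proof.
rewrite -{1}[M]submxK mul_block_col dotp_col_mx !dotpDr dotpDl.
have -> : ursubmx M *m y = (dotp (ursubmx M)^T y)%:M.
  by rewrite /dotp trmxK -mx11_scalar.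
rewrite [ulsubmx M]mx11_scalar -scalar_mxM !dotp_scalar !mul_mx_scalar dotpZr.
by rewrite !mxE lshift0 (dotpC y); ring.
Qed.

Lemma mxtrace_block1 {R : realType} n (M : 'M[R]_(1 + n)) :
  \tr M = M 0 0 + \tr (drsubmx M).
Proof. by rewrite -{1}[M]submxK mxtrace_block trace_mx11 !mxE lshift0. Qed.

(** * Gaussian integrals of quadratic functions *)

Section schur_complement.
Context {R : realType} {n : nat}.
Variables (a : R) (r : 'rV[R]_n) (N : 'M[R]_n).
Let M : 'M[R]_(1 + n) := block_mx a%:M r r^T N.
Let S := N - a^-1 *: (r^T *m r).

(** Completing the square in the first coordinate. *)
Lemma schur_dotp (x : R) (y : 'cV[R]_n) : a != 0 ->
  dotp (col_mx x%:M y) (M *m col_mx x%:M y) =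
  a * (x + dotp r^T y / a) ^+ 2 + dotp y (S *m y).
Proof.
move=> a0; rewrite /M mul_block_col dotp_col_mx !dotpDr /S mulmxBl.
rewrite dotpDr dotpNr -scalemxAl dotpZr.
have -> : r *m y = (dotp r^T y)%:M by rewrite /dotp trmxK -mx11_scalar.
rewrite -scalar_mxM !dotp_scalar mul_mx_scalar dotpZr (dotpC y r^T).
rewrite -mulmxA [r *m y]mx11_scalar mul_mx_scalar dotpZr (dotpC y r^T).
rewrite -[r in (r *m y) 0 0]trmxK -/(dotp r^T y).
by field.
Qed.

Lemma schur_det : a != 0 -> \det M = a * \det S.
Proof.
move=> a0.
have -> : M = block_mx 1%:M 0 (a^-1 *: r^T) 1%:M *m block_mx a%:M r 0 S.
  rewrite mulmx_block !mul0mx !mul1mx !addr0 mul_mx_scalar scalerA.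
  by rewrite mulfV// scale1r -scalemxAl /S addrC subrK.
by rewrite det_mulmx det_lblock det_ublock !det1 !mul1r det_scalar1.
Qed.

(** The first basis vector gives [a > 0]. For fixed [y], the value [x = - <r^T, y> / a] makes the
    square vanish and leaves the form of [S]. *)
Lemma schur_posdef : posdef M -> 0 < a /\ posdef S.
Proof.
move=> [sM pM].
have a0 : 0 < a.
  have := pM (col_mx 1%:M 0); rewrite /M mul_block_col !mulmx0 !addr0 mulmx1.
  rewrite dotp_col_mx dotp_scalar mul1r mulmx1.
  rewrite (_ : dotp 0 _ = 0) ?addr0; last first.
    by rewrite -(scale0r 0) dotpZl mul0r.
  apply; rewrite col_mx_eq0 negb_and; apply/orP; left.
  by apply/eqP => /matrixP/(_ 0 0)/eqP; rewrite !mxE eqxx oner_eq0.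
split=> //; split.
  move: sM; rewrite /M tr_block_mx => /eq_block_mx[_ _ _ sN].
  by rewrite /S linearB linearZ/= sN trmx_mul trmxK.
move=> y y0.
have := pM (col_mx (- dotp r^T y / a)%:M y); rewrite schur_dotp ?gt_eqF//.
rewrite mulNr addNr expr0n mulr0 add0r; apply.
by rewrite col_mx_eq0 negb_and y0 orbT.
Qed.

End schur_complement.

Section gaussian_integrals.
Context {R : realType}.
Local Notation N01 := (@normal_prob R 0 1).
Local Notation gamma n := (@std_gaussian R n).

Definition vec n (z : n.-tuple R) : 'cV[R]_n := \col_k tnth z k.

Lemma measurable_vec n : measurable_cV (@vec n).
Proof. by move=> k; under eq_fun do rewrite mxE; exact: measurable_tnth. Qed.

Lemma vec_tcons n (x : R) (y : n.-tuple R) :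
  vec (tcons (x, y)) = col_mx x%:M (vec y) :> 'cV_(1 + n).
Proof.
apply/matrixP => i j; rewrite ord1 [LHS]mxE.
rewrite -(splitK i); case: (fintype.split i) => k /=.
  rewrite col_mxEu ord1 mxE eqxx mulr1n; exact: (tnth_nth 0).
by rewrite col_mxEd mxE !(tnth_nth 0).
Qed.

Lemma dotp_vec_tcons n (x : R) (y : n.-tuple R) :
  dotp (vec (tcons (x, y))) (vec (tcons (x, y))) = x * x + dotp (vec y) (vec y).
Proof. by rewrite -[LHS]/(@dotp R (1 + n) _ _) vec_tcons dotp_col_mx dotp_scalar. Qed.

Lemma vec_eta n (z : n.+1.-tuple R) :
  vec z = col_mx (thead z)%:M (vec [tuple of behead z]) :> 'cV_(1 + n).
Proof. by rewrite -vec_tcons [in LHS](tuple_eta z). Qed.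

Lemma std_gaussian_cst n (c : R) : (\int[gamma n]_z c%:E = c%:E)%E.
Proof.
transitivity (\int[gamma n]_z cst c%:E z)%E => //.
by rewrite integral_cst//= probability_setT mule1.
Qed.

(** In the first coordinate [x] the function reads [x^2 M_00 + x q1 + q2], with [q1] affine and [q2]
    quadratic in the other coordinates. Allowing [b] and [c] makes both instances of the induction
    hypothesis; [E x = 0] and [E x^2 = 1] finish. *)
Lemma gaussian_quadratic n (M : 'M[R]_n) (b : 'cV_n) (c : R) :
  let q z := dotp (vec z) (M *m vec z) + dotp b (vec z) + c in
  (gamma n).-integrable setT (EFin \o q) /\
  (\int[gamma n]_z (q z)%:E = (\tr M + c)%:E)%E.
Proof.
elim: n M b c => [|n IH] M b c q.
  have -> : q = cst c.
    by apply/funext => z; rewrite /q !dotpE !big_ord0 !add0r.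
  split; first exact: finite_measure_integrable_cst.
  rewrite /mxtrace big_ord0 add0r; exact: std_gaussian_cst.
pose M1 : 'M[R]_(1 + n) := M; pose b1 : 'cV[R]_(1 + n) := b.
pose s := (ursubmx M1)^T + dlsubmx M1.
have [I1 E1] := IH 0 s (b1 0 0).
have [I2 E2] := IH (drsubmx M1) (dsubmx b1) c.
set q1 := fun z => _ in I1 E1; set q2 := fun z => _ in I2 E2.
have [J1 F1] := std_gaussianS_prod integrable_normal_id I1.
have [J2 F2] := std_gaussianS_prod (finite_measure_integrable_cst _ 1 measurableT) I2.
have [J3 F3] := std_gaussianS_prod integrable_normal_sqr
   (finite_measure_integrable_cst (gamma n) (M1 0 0) measurableT).
have qE z : q z = thead z ^+ 2 * M1 0 0 + thead z * q1 [tuple of behead z]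
    + 1 * q2 [tuple of behead z].
  rewrite /q -/M1 -/b1 vec_eta dotp_block1 dotp_col_mx1.
  by rewrite /q1 /q2 mul0mx dotp0r -/s; ring.
pose Q1 z := (thead z * q1 [tuple of behead z])%:E.
pose Q2 (z : n.+1.-tuple R) := (1 * q2 [tuple of behead z])%:E.
pose Q3 (z : n.+1.-tuple R) := (thead z ^+ 2 * M1 0 0)%:E.
have I13 := integrableD measurableT J3 J1.
have QE : EFin \o q = (Q3 \+ Q1 \+ Q2)%E by apply/funext => z; rewrite /= qE.
split; first by rewrite QE; apply: integrableD.
transitivity (\int[gamma n.+1]_z (Q3 z + Q1 z + Q2 z))%E.
  by apply: eq_integral => z _; rewrite qE.
rewrite integralD// integralD// F1 F2 F3 E1 E2 normal_sqr_expectation.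
rewrite normal_expectation /cst normal_cst_expectation std_gaussian_cst.
rewrite mul0e adde0 !mul1e -EFinD addrA; congr (_ + _)%:E.
exact/esym/mxtrace_block1.
Qed.

(* Integrating out the first coordinate replaces [N] by its Schur complement. *)
Lemma gaussian_exp_quadratic n (N : 'M[R]_n) (w : 'cV_n) : posdef N ->
  (\int[gamma n]_z (expR (dotp (vec z) (vec z) / 2 -
     dotp (vec z + w) (N *m (vec z + w)) / 2))%:E =
   ((Num.sqrt (\det N))^-1)%:E)%E.
Proof.
elim: n N w => [|n IH] N w pN.
  rewrite -[RHS](std_gaussian_cst 0); apply: eq_integral => z _.
  by rewrite !dotpE !big_ord0 subrr expR0 det_mx00 sqrtr1 invr1.
pose N1 : 'M[R]_(1 + n) := N; pose w1 : 'cV[R]_(1 + n) := w.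
pose a := N1 0 0; pose r := ursubmx N1; pose N' := drsubmx N1.
have N1E : N1 = block_mx a%:M r r^T N'.
  rewrite -[LHS]submxK; congr block_mx.
    by rewrite [LHS]mx11_scalar !mxE lshift0.
  by rewrite /r trmx_ursub; congr dlsubmx; exact: esym (proj1 pN).
have : posdef N1 by [].
rewrite N1E => /schur_posdef[a0 pS]; set S := (N' - _) in pS.
have -> : \det N = a * \det S by rewrite -schur_det ?gt_eqF// -N1E.
have mexp : measurable_fun setT (fun z : n.+1.-tuple R =>
    (expR (dotp (vec z) (vec z) / 2 -
       dotp (vec z + w) (N *m (vec z + w)) / 2))%:E).
  have mv := @measurable_vec n.+1; have mvw := measurable_cVD mv (measurable_cV_cst w).
  apply/measurable_EFinP; apply: measurableT_comp => //.
  apply: measurable_funB; apply: measurable_funM => //; first exact: measurable_dotp.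
  by apply: measurable_dotp => //; exact: measurable_cV_mulmx.
rewrite ge0_integral_std_gaussianS//.
pose c (y : n.-tuple R) := w1 0 0 + dotp r^T (vec y + dsubmx w1) / a.
pose B (y : n.-tuple R) := dotp (vec y) (vec y) / 2 -
   dotp (vec y + dsubmx w1) (S *m (vec y + dsubmx w1)) / 2.
have step x y : dotp (vec (tcons (x, y))) (vec (tcons (x, y))) / 2 -
    dotp (vec (tcons (x, y)) + w) (N *m (vec (tcons (x, y)) + w)) / 2 =
    B y + (x ^+ 2 / 2 - a * (x + c y) ^+ 2 / 2).
  rewrite dotp_vec_tcons -[N]/N1 -[w]/w1 vec_tcons N1E.
  have -> : col_mx x%:M (vec y) + w1 =
      col_mx (x + w1 0 0)%:M (vec y + dsubmx w1).
    rewrite -{1}[w1]vsubmxK add_col_mx [usubmx w1]mx11_scalar mxE lshift0.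
    by rewrite -raddfD.
  by rewrite schur_dotp ?gt_eqF// /B /c; field; rewrite gt_eqF.
transitivity (\int[gamma n]_y ((expR (B y))%:E * ((Num.sqrt a)^-1)%:E))%E.
  apply: eq_integral => y _; rewrite -(normal_exp_quadratic (c y) a0).
  rewrite -ge0_integralZl//; last first.
    by apply/measurable_EFinP; apply: measurableT_comp => //; measurable_poly.
  by apply: eq_integral => x _; rewrite step expRD EFinM.
rewrite ge0_integralZr//; last first.
  have mv := @measurable_vec n.
  have mvw := measurable_cVD mv (measurable_cV_cst (dsubmx w1)).
  apply/measurable_EFinP; apply: measurableT_comp => //.
  apply: measurable_funB; apply: measurable_funM => //; first exact: measurable_dotp.
  by apply: measurable_dotp => //; exact: measurable_cV_mulmx.
by rewrite IH// sqrtrM ?ltW// invfM mulrC EFinM.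
Qed.

End gaussian_integrals.

(** * Laplace transform of a whitened log-likelihood ratio *)

Section renyi_scalar.
Context {R : realType}.

(* The two sides agree at [d = 1], and the derivative of their difference is
   [l (d - 1) / (d g) * (1 - l - e g)] with [g = 1 - l + l d]. *)
Lemma ln_convex_gap (l e d : R) : 0 < l < 1 -> 0 <= e -> e <= 1 - l -> 0 < d ->
  e * (1 - l + l * d) <= 1 - l ->
  l * ln d + e * l * (d - 1 - ln d) <= ln (1 - l + l * d).
Proof.
move=> /andP[l0 l1] e0 el d0 ed.
pose f (x : R) := ln (1 - l + l * x) - (1 - e) * l * ln x - e * l * x.
pose f' (x : R) := l / (1 - l + l * x) - (1 - e) * l / x - e * l.
suff : f 1 <= f d.
  by rewrite /f mulr1 subrK ln1 mulr0 !subr0 sub0r mulr1; lra.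
have g0 (x : R) : 0 < x -> 0 < 1 - l + l * x by move=> x0; nra.
have fD (x : R) : 0 < x -> is_derive x 1 f (f' x).
  move=> x0; have gx := g0 _ x0.
  have D1 : is_derive x 1 (cst (1 - l) + l \*: (id : R^o -> R^o)) (0 + l *: 1).
    exact: is_deriveD.
  have D2 := is_derive1_comp (f := @ln R) (g := cst (1 - l) + l \*: (id : R^o -> R^o))
    (is_derive1_ln gx) D1.
  have D3 := is_deriveB D2 (is_deriveZ ((1 - e) * l) (is_derive1_ln x0)).
  have D4 := is_deriveB D3 (is_deriveZ (e * l) (is_derive_id x 1)).
  apply: (@is_derive_eq _ _ _ _ _ _ _ _ D4).
  by rewrite /f' add0r /GRing.scale /= !mulr1 mulrC.
have f'E (x : R) : 0 < x -> f' x = l * (x - 1) / (x * (1 - l + l * x)) *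
   (1 - l - e * (1 - l + l * x)).
  by move=> x0; rewrite /f'; field; rewrite !gt_eqF ?g0.
have [d1|d1|->] := ltgtP d 1; last by [].
- have [] := @MVT _ f f' d 1 d1.
  + by move=> x; rewrite in_itv => /andP[dx _]; apply: fD; exact: lt_trans dx.
  + apply: derivable_within_continuous => x; rewrite in_itv/= => /andP[dx _].
    by apply: ex_derive; apply: fD; exact: lt_le_trans dx.
  move=> x; rewrite in_itv/= => /andP[dx x1] fE.
  rewrite -subr_le0 fE f'E; last by lra.
  have x0 : 0 < x by lra.
  rewrite mulr_le0_ge0//; last by lra.
  rewrite mulr_le0_ge0//; last by nra.
  rewrite mulr_le0_ge0//; first by nra.
  by rewrite invr_ge0 mulr_ge0 ?ltW ?g0.
- have [] := @MVT _ f f' 1 d d1.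
  + move=> x; rewrite in_itv => /andP[dx _]; apply: fD; exact: lt_trans dx.
  + apply: derivable_within_continuous => x; rewrite in_itv/= => /andP[dx _].
    by apply: ex_derive; apply: fD; exact: lt_le_trans dx.
  move=> x; rewrite in_itv/= => /andP[dx x1] fE.
  rewrite -subr_ge0 fE f'E; last by lra.
  have x0 : 0 < x by lra.
  rewrite mulr_ge0//; last by lra.
  rewrite mulr_ge0//; last by nra.
  rewrite mulr_ge0//; first by nra.
  by rewrite invr_ge0 mulr_ge0 ?ltW ?g0.
Qed.

End renyi_scalar.

(** * Matrices diagonal in a fixed orthonormal basis *)

Section orthogonal_diagonalization.
Context {R : realType} {n : nat}.
Variables (U : 'M[R]_n) (UU : U^T *m U = 1%:M).
Implicit Types (d : 'rV[R]_n) (x : 'cV[R]_n).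

Definition odiag d := U *m diag_mx d *m U^T.

Lemma odiag_sym d : (odiag d)^T = odiag d.
Proof. by rewrite /odiag !trmx_mul trmxK tr_diag_mx mulmxA. Qed.

Lemma odiag_mul d e : odiag d *m odiag e = odiag (\row_k (d 0 k * e 0 k)).
Proof.
rewrite /odiag -!mulmxA (mulmxA U^T) UU mul1mx (mulmxA (diag_mx d)).
by rewrite mulmx_diag.
Qed.

Lemma odiagD d e : odiag d + odiag e = odiag (d + e).
Proof. by rewrite /odiag raddfD /= mulmxDr mulmxDl. Qed.

Lemma odiagZ a d : a *: odiag d = odiag (a *: d).
Proof. by rewrite /odiag linearZ /= -scalemxAr -scalemxAl. Qed.

Lemma odiag_const a : a%:M = odiag (const_mx a).
Proof.
by rewrite /odiag diag_const_mx mul_mx_scalar -scalemxAl (mulmx1C UU) scalemx1.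
Qed.

Lemma odiag_det d : \det (odiag d) = \prod_k d 0 k.
Proof.
by rewrite /odiag !det_mulmx mulrAC -det_mulmx (mulmx1C UU) det1 mul1r det_diag.
Qed.

Lemma odiag_tr d : \tr (odiag d) = \sum_k d 0 k.
Proof. by rewrite /odiag mxtrace_mulC mulmxA UU mul1mx mxtrace_diag. Qed.

Lemma odiag_dotp d x y : dotp x (odiag d *m y) =
  \sum_k d 0 k * ((U^T *m x) k 0 * (U^T *m y) k 0).
Proof.
rewrite /odiag -!mulmxA dotp_mulmx dotpE; apply: eq_bigr => k _.
by rewrite mul_diag_mx [X in _ * X = _]mxE mulrCA.
Qed.

Lemma orthogonal_dotp x y :
  dotp x y = \sum_k (U^T *m x) k 0 * (U^T *m y) k 0.
Proof.
rewrite -[y in LHS]mul1mx odiag_const odiag_dotp.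
by apply: eq_bigr => k _; rewrite mxE mul1r.
Qed.

Lemma odiag_col d k : dotp (col k U) (odiag d *m col k U) = d 0 k.
Proof.
rewrite odiag_dotp (bigD1 k)//= big1 => [|l lk];
  rewrite colE mulmxA UU mul1mx !mxE ?eqxx ?mulr1 ?addr0//.
by rewrite (negbTE lk) !mulr0.
Qed.

Lemma orthogonal_tr_eq0 x : (U^T *m x == 0) = (x == 0).
Proof.
apply/eqP/eqP => [h|->]; last by rewrite mulmx0.
by rewrite -[x]mul1mx -(mulmx1C UU) -mulmxA h mulmx0.
Qed.

Lemma odiag_posdef d : posdef (odiag d) <-> forall k, 0 < d 0 k.
Proof.
split=> [[_ pd] k|d0].
  rewrite -odiag_col pd//; apply/eqP => /(congr1 (mulmx U^T)).
  rewrite mulmx0 colE mulmxA UU mul1mx => /matrixP/(_ k 0)/eqP.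
  by rewrite !mxE !eqxx oner_eq0.
split=> [|x]; first exact: odiag_sym.
have p0 k : 0 <= d 0 k * ((U^T *m x) k 0 * (U^T *m x) k 0).
  by apply: mulr_ge0; [exact: ltW | rewrite -expr2 sqr_ge0].
rewrite -orthogonal_tr_eq0 odiag_dotp lt0r sumr_ge0 ?andbT//.
apply: contraNN; rewrite psumr_eq0// => /allP h.
apply/eqP/colP => k; rewrite [RHS]mxE; apply/eqP.
have := h k (mem_index_enum _).
by rewrite /= mulf_eq0 gt_eqF//= -expr2 sqrf_eq0.
Qed.

End orthogonal_diagonalization.

Section whitened_llr.
Context {R : realType} {n : nat}.
Variables (Q : 'M[R]_n) (v : 'cV[R]_n).
Hypothesis pQ : posdef Q.
Local Notation gamma := (@std_gaussian R n).

(* The log-likelihood ratio of N(0, I) to N(-v, Q^-1). *)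
Definition wllr (z : n.-tuple R) : R :=
  (dotp (vec z + v) (Q *m (vec z + v)) - dotp (vec z) (vec z) - ln (\det Q)) / 2.

(** The closed form of KL(N(0, I) || N(- v, Q^-1)). *)
Definition wkl : R :=
  (\tr Q - n%:R - ln (\det Q) + dotp v (Q *m v)) / 2.

Lemma wllr_expectation :
  gamma.-integrable setT (EFin \o wllr) /\
  (\int[gamma]_z (wllr z)%:E = wkl%:E)%E.
Proof.
have [I E] := gaussian_quadratic (2^-1 *: (Q - 1%:M)) (Q *m v)
  ((dotp v (Q *m v) - ln (\det Q)) / 2).
have wE : (fun z : n.-tuple R => dotp (vec z) (2^-1 *: (Q - 1%:M) *m vec z) +
    dotp (Q *m v) (vec z) + (dotp v (Q *m v) - ln (\det Q)) / 2) = wllr.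
  apply/funext => z; rewrite /wllr mulmxDr dotpDl !dotpDr.
  rewrite -scalemxAl dotpZr mulmxBl mul1mx dotpDr dotpNr.
  by rewrite [dotp v (Q *m vec z)]dotp_mulmx (proj1 pQ) (dotpC (vec z) (Q *m v)); field.
split; first by rewrite -wE.
rewrite -wE E; congr EFin; rewrite /wkl mxtraceZ raddfB /= mxtrace_scalar.
by field.
Qed.

Lemma sum_ln_prod (f : 'I_n -> R) : (forall k, 0 < f k) ->
  ln (\prod_k f k) = \sum_k ln (f k).
Proof.
move=> f0; suff [] : 0 < \prod_k f k /\ ln (\prod_k f k) = \sum_k ln (f k) by [].
apply: (big_ind2 (fun x y => 0 < x /\ ln x = y)).
- by rewrite ln1.
- by move=> a b c d [a0 <-] [c0 <-]; rewrite mulr_gt0// lnM.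
- by move=> k _.
Qed.

(** The exponent is quadratic with matrix [N = (1 - l) I + l Q], so the integral is explicit. The
    condition on [e] is stated with quadratic forms, so that it can be verified without
    diagonalizing [Q]; on eigenvectors it becomes [e (1 - l + l d) <= 1 - l]. *)
Lemma wllr_mgf (l e : R) : 0 < l < 1 -> 0 <= e -> e <= 1 - l ->
  (forall x, e * ((1 - l) * dotp x x + l * dotp x (Q *m x)) <=
             (1 - l) * dotp x x) ->
  (\int[gamma]_z (expR (- l * wllr z))%:E <= (expR (- (e * l * wkl)))%:E)%E.
Proof.
move=> l01 e0 el eQ; have [l0 l1] := andP l01.
have [U [d [UU QE]]] := spectral_theorem (proj1 pQ).
rewrite -/(odiag U d) in QE.
have d0 : forall k, 0 < d 0 k by apply/(odiag_posdef UU); rewrite -QE.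
pose g : 'rV[R]_n := \row_k (1 - l + l * d 0 k).
have gE k : g 0 k = 1 - l + l * d 0 k by rewrite mxE.
have g0 k : 0 < g 0 k by rewrite gE; have := d0 k; nra.
have eg k : e * g 0 k <= 1 - l.
  have := eQ (col k U); rewrite QE odiag_col// gE.
  have -> : dotp (col k U) (col k U) = 1.
    have := odiag_col UU (const_mx 1) k.
    by rewrite -odiag_const// mul1mx mxE.
  by rewrite !mulr1.
pose N := odiag U g.
have NE : N = (1 - l)%:M + l *: Q.
  rewrite QE odiagZ (odiag_const UU) odiagD; congr odiag.
  by apply/rowP => k; rewrite !mxE.
have pN : posdef N by apply/odiag_posdef.
pose c := U^T *m v.
pose h : 'rV[R]_n := \row_k (l * d 0 k / g 0 k).
(* The centre of the square: the solution of [N w = l Q v], for which the linear terms agree. *)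
pose w := odiag U h *m v.
have Nw : N *m w = l *: (Q *m v).
  rewrite mulmxA odiag_mul// QE scalemxAl odiagZ; congr (odiag _ _ *m _).
  by apply/rowP => k; rewrite !mxE -gE mulrCA divff ?mulr1 ?gt_eqF.
pose kap := l * dotp v (Q *m v) - dotp w (N *m w).
have sq (z : n.-tuple R) : - l * wllr z =
   (l * ln (\det Q) - kap) / 2 + (dotp (vec z) (vec z) / 2 -
    dotp (vec z + w) (N *m (vec z + w)) / 2).
  have -> : dotp (vec z + w) (N *m (vec z + w)) =
      dotp (vec z) (N *m vec z) + 2 * dotp (vec z) (N *m w) + dotp w (N *m w).
    rewrite mulmxDr dotpDl !dotpDr [dotp w (N *m vec z)]dotp_mulmx (proj1 pN).
    by rewrite (dotpC (N *m w)); ring.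
  rewrite Nw dotpZr NE mulmxDl dotpDr mul_scalar_mx dotpZr -scalemxAl dotpZr.
  rewrite /wllr /kap Nw dotpZr mulmxDr dotpDl !dotpDr.
  rewrite [dotp v (Q *m vec z)]dotp_mulmx (proj1 pQ) (dotpC (Q *m v)).
  by field.
under eq_integral do rewrite sq expRD EFinM.
rewrite ge0_integralZl//; last first.
  have mv := @measurable_vec R n.
  have mvw := measurable_cVD mv (measurable_cV_cst w).
  apply/measurable_EFinP; apply: measurableT_comp => //.
  apply: measurable_funB; apply: measurable_funM => //; first exact: measurable_dotp.
  by apply: measurable_dotp => //; exact: measurable_cV_mulmx.
rewrite gaussian_exp_quadratic// -EFinM lee_fin.
have detN : 0 < \det N by rewrite odiag_det// prodr_gt0.
rewrite -(powR12_sqrt (ltW detN)) /powR gt_eqF//= -expRN -expRD ler_expR.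
have vQv : dotp v (Q *m v) = \sum_k d 0 k * c k 0 ^+ 2.
  by rewrite QE odiag_dotp; apply: eq_bigr => k _; rewrite expr2.
have wNw : dotp w (N *m w) = \sum_k h 0 k * (l * d 0 k) * c k 0 ^+ 2.
  rewrite Nw QE scalemxAl odiagZ /w dotpC dotp_mulmx odiag_sym dotpC mulmxA.
  rewrite odiag_mul// odiag_dotp; apply: eq_bigr => k _.
  by rewrite !mxE expr2.
rewrite /kap vQv wNw /wkl vQv QE odiag_tr// !odiag_det// !sum_ln_prod//.
rewrite -subr_ge0.
(* In each summand the first half collects the determinant and trace terms and is nonnegative by
   [ln_convex_gap]; the second half is the contribution of the shift [v]. *)
rewrite (_ : _ - _ = \sum_k ((ln (g 0 k) - l * ln (d 0 k) -
    e * l * (d 0 k - 1 - ln (d 0 k))) / 2 +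
    l * d 0 k * c k 0 ^+ 2 * (1 - h 0 k - e) / 2)); last first.
  under [RHS]eq_bigr => k _.
    rewrite (_ : _ + _ = 2^-1 * ln (g 0 k) + (- (l * (1 - e)) / 2) * ln (d 0 k) +
      (- (e * l) / 2) * d 0 k + (e * l / 2) * 1 +
      (l * (1 - e) / 2) * (d 0 k * c k 0 ^+ 2) +
      (- 2^-1) * (h 0 k * (l * d 0 k) * c k 0 ^+ 2)); last by field.
    over.
  by rewrite !big_split /= -!mulr_sumr sumr_const card_ord; field.
apply: sumr_ge0 => k _; apply: addr_ge0.
  have := ln_convex_gap l01 e0 el (d0 k); rewrite -gE => /(_ (eg k)); lra.
rewrite divr_ge0// mulr_ge0//.
  by rewrite mulr_ge0 ?sqr_ge0// mulr_ge0 ?(ltW (d0 k))// ltW.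
(* With this identity, [e <= 1 - h_k] is the bound [eg]. *)
have -> : 1 - h 0 k = (1 - l) / g 0 k.
  by rewrite mxE mxE; field; rewrite -gE gt_eqF.
by rewrite subr_ge0 ler_pdivlMr.
Qed.

(** Only the mean term is kept; the rest is a sum of [d - 1 - ln d >= 0] over the eigenvalues [d] of
    [Q]. *)
Lemma wkl_ge : dotp v (Q *m v) / 2 <= wkl.
Proof.
have [U [d [UU QE]]] := spectral_theorem (proj1 pQ).
rewrite -/(odiag U d) in QE.
have d0 : forall k, 0 < d 0 k by apply/(odiag_posdef UU); rewrite -QE.
rewrite ler_pM2r ?invr_gt0// lerDr QE odiag_tr// odiag_det// sum_ln_prod//.
rewrite -[n in n%:R]card_ord -sumr_const -!sumrB; apply: sumr_ge0 => k _.
have := @le_ln1Dx _ (d 0 k - 1); rewrite subrKC subr_ge0; apply.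
by have := d0 k; lra.
Qed.

Lemma measurable_wllr : measurable_fun setT wllr.
Proof.
have mv := @measurable_vec R n; have mvv := measurable_cVD mv (measurable_cV_cst v).
apply: measurable_funM => //; apply: measurable_funB => //.
apply: measurable_funB; apply: measurable_dotp => //.
exact: measurable_cV_mulmx.
Qed.

Lemma wllr_chernoff (l e c : R) : 0 < l < 1 -> 0 <= e -> e <= 1 - l ->
  (forall x, e * ((1 - l) * dotp x x + l * dotp x (Q *m x)) <=
             (1 - l) * dotp x x) ->
  (gamma [set z | wllr z <= c]%R <= (expR (l * c - e * l * wkl))%:E)%E.
Proof.
move=> l01 e0 el eQ; have [l0 _] := andP l01.
have mA : measurable [set z | wllr z <= c].
  rewrite -[X in measurable X]setTI.
  by apply: measurable_fun_le => //; exact: measurable_wllr.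
rewrite -(setIT [set z | _]) -integral_indic//.
apply: (@le_trans _ _ (\int[gamma]_z ((expR (l * c))%:E * (expR (- l * wllr z))%:E))%E).
  apply: ge0_le_integral => //.
  - exact/measurable_EFinP/measurable_indic.
  - apply: emeasurable_funM => //; apply/measurable_EFinP.
    apply: measurableT_comp => //; apply: measurable_funM => //.
    exact: measurable_wllr.
  - move=> z _; rewrite indicE -EFinM -expRD lee_fin.
    have [zA|_] := boolP (z \in _); last exact: expR_ge0.
    rewrite -[leLHS]expR0 ler_expR; move: zA; rewrite inE /= => zc; nra.
rewrite ge0_integralZl//; last first.
  apply/measurable_EFinP; apply: measurableT_comp => //.
  by apply: measurable_funM => //; exact: measurable_wllr.
by rewrite expRD EFinM lee_pmul2l ?lte_fin ?expR_gt0// wllr_mgf.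
Qed.

End whitened_llr.

(** * Gaussian laws on column vectors *)

Section borel_vectors.
Context {R : realType} {n : nat}.

Lemma measurable_cV_id : measurable_cV (@id 'cV[R]_n).
Proof.
move=> k _ A mA; rewrite setTI; apply: sub_sigma_algebra.
by exists k, 0, A.
Qed.

Lemma measurable_fun_cV d (T : measurableType d) (f : T -> 'cV[R]_n) :
  measurable_cV f -> measurable_fun setT f.
Proof.
move=> mf; apply: (measurability (@mx_cylinders R n 1)) => //.
move=> _ [_ [i [j [A [mA ->]]]] <-].
have := mf i measurableT A mA.
by rewrite (ord1 j).
Qed.

End borel_vectors.

Section posdef_theory.
Context {R : realType} {n : nat}.
Implicit Types S : 'M[R]_n.

Lemma posdef_odiag S : posdef S -> exists (U : 'M[R]_n) (d : 'rV[R]_n),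
  [/\ U^T *m U = 1%:M, S = odiag U d & forall k, 0 < d 0 k].
Proof.
move=> pS; have [U [d [UU SE]]] := spectral_theorem (proj1 pS).
by exists U, d; split=> //; apply/(odiag_posdef UU); rewrite /odiag -SE.
Qed.

Lemma posdef_det S : posdef S -> 0 < \det S.
Proof.
by move=> /posdef_odiag[U [d [UU -> d0]]]; rewrite odiag_det// prodr_gt0.
Qed.

Lemma posdef_unitmx S : posdef S -> S \in unitmx.
Proof. by move=> pS; rewrite unitmxE unitfE gt_eqF// posdef_det. Qed.

(** [mx_root] is a choice with default [0], so a root has to be exhibited: the symmetric one, in an
    eigenbasis. Of the chosen root, only this equation is used afterwards. *)
Lemma mx_rootP S : posdef S -> mx_root S *m (mx_root S)^T = S.
Proof.
move=> /posdef_odiag[U [d [UU SE d0]]].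
apply: (@xgetPex _ 0 [set B : 'M[R]_n | B *m B^T = S]).
exists (odiag U (\row_k Num.sqrt (d 0 k))).
rewrite /= odiag_sym odiag_mul// SE; congr odiag.
by apply/rowP => k; rewrite !mxE -expr2 sqr_sqrtr// ltW.
Qed.

Lemma mx_root_unit S : posdef S -> mx_root S \in unitmx.
Proof.
move=> pS; have := posdef_unitmx pS; rewrite -{1}(mx_rootP pS).
by rewrite unitmx_mul => /andP[].
Qed.

Lemma invmx_sym S : S^T = S -> (invmx S)^T = invmx S.
Proof. by move=> sS; rewrite trmx_inv sS. Qed.

End posdef_theory.

Lemma posdef_invmx {R : realType} n (S : 'M[R]_n) : posdef S -> posdef (invmx S).
Proof.
move=> pS; have uS := posdef_unitmx pS; split; first by rewrite invmx_sym ?(proj1 pS).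
move=> x x0; have y0 : invmx S *m x != 0.
  by apply: contraNneq x0 => h; rewrite -[x](mulKVmx uS) h mulmx0.
by have := proj2 pS _ y0; rewrite (mulKVmx uS) dotpC.
Qed.

Section gaussian_density.
Context {R : realType} {n : nat}.
Variables (a : 'cV[R]_n) (S : 'M[R]_n).
Hypothesis pS : posdef S.

Lemma gaussian_pdf_gt0 x : 0 < gaussian_pdf a S x.
Proof.
rewrite mulr_gt0 ?expR_gt0// invr_gt0 sqrtr_gt0 mulr_gt0 ?posdef_det//.
by rewrite exprn_gt0// mulrn_wgt0// pi_gt0.
Qed.

Lemma gaussian_pdfE x : gaussian_pdf a S x =
  (Num.sqrt ((pi *+ 2) ^+ n))^-1 *
  expR (- (dotp (x - a) (invmx S *m (x - a)) + ln (\det S)) / 2).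
Proof.
have pi0 : 0 <= (pi *+ 2 : R) ^+ n by rewrite exprn_ge0// mulrn_wge0// pi_ge0.
rewrite /gaussian_pdf sqrtrM// invfM -mulrA; congr (_ * _).
have dS := posdef_det pS.
rewrite -(powR12_sqrt (ltW dS)) /powR gt_eqF//= -expRN -expRD; congr expR.
by field.
Qed.

Lemma measurable_quadratic_form (N : 'M[R]_n) :
  measurable_fun setT (fun x : 'cV[R]_n => dotp (x - a) (N *m (x - a))).
Proof.
have mv := measurable_cVB (@measurable_cV_id R n) (measurable_cV_cst a).
by apply: measurable_dotp => //; exact: measurable_cV_mulmx.
Qed.

Lemma measurable_gaussian_pdf : measurable_fun setT (gaussian_pdf a S).
Proof.
apply: measurable_funM => //; apply: measurableT_comp => //.
apply: measurableT_comp => //; apply: measurable_funM => //.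
exact: measurable_quadratic_form.
Qed.

Lemma measurable_gaussian_map :
  measurable_fun setT (fun z : n.-tuple R => a + mx_root S *m vec z).
Proof.
apply: measurable_fun_cV; apply: measurable_cVD; first exact: measurable_cV_cst.
exact: measurable_cV_mulmx (@measurable_vec R n).
Qed.

End gaussian_density.

(** * Whitening the log-likelihood ratio of two Gaussian laws *)

Section gaussian_llr.
Context {R : realType} {n : nat}.
Variables (a b : 'cV[R]_n) (S S' : 'M[R]_n).
Hypotheses (pS : posdef S) (pS' : posdef S').

Definition gllr (x : 'cV[R]_n) : R :=
  (dotp (x - b) (invmx S' *m (x - b)) - dotp (x - a) (invmx S *m (x - a))
   + ln (\det S') - ln (\det S)) / 2.

Lemma ln_gaussian_pdf_ratio x :
  ln (gaussian_pdf a S x / gaussian_pdf b S' x) = gllr x.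
Proof.
have pi0 : 0 < (pi *+ 2 : R) ^+ n by rewrite exprn_gt0// mulrn_wgt0// pi_gt0.
rewrite !gaussian_pdfE// -mulf_div divff ?mul1r; last first.
  by rewrite invr_eq0 gt_eqF// sqrtr_gt0.
by rewrite -expRB expRK /gllr; field.
Qed.

Lemma measurable_gllr : measurable_fun setT gllr.
Proof.
apply: measurable_funM => //; apply: measurable_funB => //.
apply: measurable_funD => //; apply: measurable_funB;
  exact: measurable_quadratic_form.
Qed.

Let B := mx_root S.

(** In the coordinates [z] with [x = a + B z], N(a, S) becomes N(0, I), and N(b, S') becomes the
    Gaussian law with precision matrix [whiten_mx] and mean [- whiten_mean]. *)
Definition whiten_mx : 'M[R]_n := B^T *m invmx S' *m B.

Definition whiten_mean : 'cV[R]_n := invmx B *m (a - b).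

Let uB : B \in unitmx. Proof. exact: mx_root_unit. Qed.

Lemma whiten_posdef : posdef whiten_mx.
Proof.
split; first by rewrite /whiten_mx !trmx_mul trmxK invmx_sym ?(proj1 pS')// mulmxA.
move=> x x0; rewrite /whiten_mx -!mulmxA dotp_mulmx trmxK.
apply: (proj2 (posdef_invmx pS')); apply: contraNneq x0 => h.
by rewrite -[x](mulKmx uB) h mulmx0.
Qed.

Lemma whiten_det : \det whiten_mx = \det S / \det S'.
Proof.
rewrite /whiten_mx !det_mulmx det_inv -[in RHS](mx_rootP pS) det_mulmx det_tr.
by rewrite mulrAC.
Qed.

Lemma whiten_dotp x :
  dotp x (whiten_mx *m x) = dotp (B *m x) (invmx S' *m (B *m x)).
Proof. by rewrite /whiten_mx -!mulmxA dotp_mulmx trmxK. Qed.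

Lemma gllr_whiten z :
  gllr (a + B *m vec z) = wllr whiten_mx whiten_mean z.
Proof.
rewrite /gllr /wllr whiten_dotp [B *m (_ + _)]mulmxDr /whiten_mean mulKVmx//.
have -> : a + B *m vec z - b = B *m vec z + (a - b) by rewrite addrAC addrC.
have -> : a + B *m vec z - a = B *m vec z by rewrite addrAC subrr add0r.
have -> : dotp (B *m vec z) (invmx S *m (B *m vec z)) = dotp (vec z) (vec z).
  rewrite dotpC dotp_mulmx; congr (dotp _ _).
  apply: (can_inj (mulKmx uB)); rewrite !mulmxA (mx_rootP pS).
  by rewrite mulmxV ?posdef_unitmx// mul1mx.
rewrite whiten_det ln_div ?posrE ?posdef_det//; ring.
Qed.

Lemma gaussian_KL :
  KL (gaussian a S) (gaussian_pdf a S) (gaussian_pdf b S') =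
  (wkl whiten_mx whiten_mean)%:E.
Proof.
rewrite /KL (_ : (fun x => _) = EFin \o gllr); last first.
  by apply/funext => x; rewrite ln_gaussian_pdf_ratio.
have [I <-] := wllr_expectation whiten_mean whiten_posdef.
have E : (EFin \o gllr) \o (fun z => a + B *m vec z) =
    EFin \o wllr whiten_mx whiten_mean.
  by apply/funext => z /=; rewrite gllr_whiten.
have mg : measurable_fun setT (EFin \o gllr).
  by apply/measurable_EFinP; exact: measurable_gllr.
rewrite [LHS](integral_pushforward (measurable_gaussian_map a S) mg _ measurableT).
  by rewrite preimage_setT E.
by rewrite preimage_setT E.
Qed.

End gaussian_llr.

Section gaussian_deviation.
Context {R : realType} {n : nat}.
Variables (a b : 'cV[R]_n) (S S' : 'M[R]_n).
Hypotheses (pS : posdef S) (pS' : posdef S').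

(** Passes from [B B^T], the covariance, to [B^T B], the matrix met after whitening. With [y = B x],
    Cauchy-Schwarz gives [|y|^4 = <x, B^T y>^2 <= |x|^2 |B^T y|^2 <= k |x|^2 |y|^2]. *)
Lemma mulmx_tr_le (B : 'M[R]_n) (k : R) :
  (forall x, dotp x (B *m B^T *m x) <= k * dotp x x) ->
  forall x, dotp (B *m x) (B *m x) <= k * dotp x x.
Proof.
move=> Bk x; set y := B *m x.
have y0 := dotp_ge0 y; have x0 := dotp_ge0 x.
have [->|yn0] := eqVneq (dotp y y) 0.
  have [->|xn0] := eqVneq (dotp x x) 0; first by rewrite mulr0.
  rewrite mulr_ge0//; have := Bk x; rewrite -mulmxA dotp_mulmx.
  have xp : 0 < dotp x x by rewrite lt0r xn0.
  by move=> /(le_trans (dotp_ge0 _)); rewrite pmulr_lge0.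
have yp : 0 < dotp y y by rewrite lt0r yn0.
have e : dotp y y = dotp x (B^T *m y) by rewrite dotp_mulmx trmxK.
have := dotp_CauchySchwarz x (B^T *m y); rewrite -e.
have -> : dotp (B^T *m y) (B^T *m y) = dotp y (B *m B^T *m y).
  by rewrite -mulmxA dotp_mulmx trmxK dotpC.
move=> h; have := le_trans h (ler_wpM2l x0 (Bk y)).
by rewrite expr2 mulrA (mulrC (dotp x x)) ler_pM2r.
Qed.

(** With [x = S'^-1 y] and [p = <x, y>], the hypothesis [s |x|^2 <= p] and [p^2 <= |x|^2 |y|^2] give
    [s p <= |y|^2]. *)
Lemma dotp_invmx_le (s : R) : 0 < s ->
  (forall x, s * dotp x x <= dotp x (S' *m x)) ->
  forall y, dotp y (invmx S' *m y) <= dotp y y / s.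
Proof.
move=> s0 sS y; have uS := posdef_unitmx pS'.
set x := invmx S' *m y; have yE : y = S' *m x by rewrite mulKVmx.
have := dotp_CauchySchwarz x y; have := sS x; rewrite -yE (dotpC y x).
have := dotp_ge0 x; have := dotp_ge0 y.
move: (dotp x x) (dotp y y) (dotp x y) => xx yy p yy0 xx0 sx cs.
rewrite ler_pdivlMr//.
have [p0|p0] := leP p 0; first by apply: le_trans yy0; rewrite pmulr_lle0.
by rewrite -(ler_pM2l p0); nra.
Qed.

Lemma whiten_mx_le (s k : R) : 0 < s ->
  (forall x, s * dotp x x <= dotp x (S' *m x)) ->
  (forall x, dotp x (S *m x) <= k * dotp x x) ->
  forall x, dotp x (whiten_mx S S' *m x) <= k / s * dotp x x.
Proof.
move=> s0 sS' kS x; rewrite whiten_dotp.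
apply: le_trans (dotp_invmx_le s0 sS' _) _.
rewrite mulrAC ler_pM2r ?invr_gt0//; apply: mulmx_tr_le => y.
by rewrite mx_rootP.
Qed.

(** Chernoff's bound with [e = 1 - tau]: since [1 - tau - eta = tau], a multiple [tau] of the
    divergence remains in the exponent. The ratio [k / s] bounds the eigenvalues of the whitened
    matrix. *)
Lemma gaussian_llr_chernoff (s k eta c : R) : 0 < s -> s <= k ->
  (forall x, s * dotp x x <= dotp x (S' *m x)) ->
  (forall x, dotp x (S *m x) <= k * dotp x x) ->
  0 < eta < 1 ->
  (gaussian a S [set x | gllr a b S S' x <=
     eta * wkl (whiten_mx S S') (whiten_mean a b S) + c]%R <=
   (expR (- ((1 - eta) / 2 / (k / s) *
     ((1 - eta) / 2 * wkl (whiten_mx S S') (whiten_mean a b S) - c))))%:E)%E.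
Proof.
move=> s0 sk sS' kS /andP[eta0 eta1].
set kl := wkl _ _; set tau := (1 - eta) / 2.
have tau0 : 0 < tau by rewrite /tau; lra.
have q1 : 1 <= k / s by rewrite ler_pdivlMr// mul1r.
have q0 : 0 < k / s by exact: lt_le_trans q1.
(* For an eigenvalue [d <= k / s] this gives [l d <= tau], hence [(1 - tau) (1 - l + l d) <= 1 - l +
   tau (l - tau)], which is at most [1 - l] because [l <= tau]. *)
pose l := tau / (k / s).
have l0 : 0 < l by rewrite divr_gt0.
have lq : l * (k / s) = tau by rewrite divfK// gt_eqF.
have lt : l <= tau by rewrite -lq ler_peMr// ltW.
have l01 : 0 < l < 1 by rewrite l0 (le_lt_trans lt)// /tau; lra.
have := @wllr_chernoff _ _ _ (whiten_mean a b S) (whiten_posdef pS pS')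
  l (1 - tau) (eta * kl + c) l01.
rewrite (_ : l * _ - _ = - (l * (tau * kl - c))); last by rewrite /kl /tau; field.
rewrite /gaussian /pushforward /=.
rewrite (_ : _ @^-1` _ =
    [set z | wllr (whiten_mx S S') (whiten_mean a b S) z <= eta * kl + c]).
  apply.
  - by rewrite /tau; lra.
  - by lra.
  move=> x; have := whiten_mx_le s0 sS' kS x; have := dotp_ge0 x.
  move: (dotp x x) (dotp x (_ *m x)) => xx xQx xx0 xQ.
  have : l * xQx <= tau * xx by rewrite -lq -mulrA ler_pM2l.
  have lt1 : l * xx <= tau * xx by rewrite ler_wpM2r.
  move=> lQ.
  have : (1 - tau) * ((1 - l) * xx + l * xQx) <= (1 - tau) * ((1 - l) * xx + tau * xx).
    rewrite ler_pM2l; last by rewrite /tau; lra.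
    by lra.
  by move=> /le_trans; apply; nra.
by apply/seteqP; split => z /=; rewrite -(gllr_whiten a b pS pS').
Qed.

Lemma wkl_whiten_ge :
  dotp (a - b) (invmx S' *m (a - b)) / 2 <=
  wkl (whiten_mx S S') (whiten_mean a b S).
Proof.
apply: le_trans (wkl_ge _ (whiten_posdef pS pS')).
by rewrite whiten_dotp /whiten_mean mulKVmx// mx_root_unit.
Qed.

End gaussian_deviation.

(** * Lower bound on the mean term of the divergence *)

Section eigenbasis.
Context {R : realType} {n : nat}.
Variables (A : 'M[R]_n) (u : 'I_n -> 'cV[R]_n).
Hypothesis uA : orthonormal_eigenbasis A u.

Let U : 'M[R]_n := \matrix_(i, k) u k i 0.

Let U_tr_mul x k : (U^T *m x) k 0 = dotp x (u k).
Proof.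
by rewrite mxE dotpE; apply: eq_bigr => i _; rewrite !mxE mulrC.
Qed.

Let U_col k : col k U = u k.
Proof. by apply/colP => i; rewrite !mxE. Qed.

Let UU : U^T *m U = 1%:M.
Proof.
apply/matrixP => k l.
have -> : (U^T *m U) k l = (U^T *m u l) k 0.
  by rewrite -(U_col l) colE mulmxA -colE [RHS]mxE.
by rewrite U_tr_mul (proj1 uA) !mxE eq_sym.
Qed.

Lemma eigenbasis_odiag : A = odiag U (\row_k eigval A k).
Proof.
suff AU : A *m U = U *m diag_mx (\row_k eigval A k).
  by rewrite /odiag -AU -mulmxA (mulmx1C UU) mulmx1.
apply/matrixP => i k; rewrite mul_mx_diag !mxE.
have /colP/(_ i) := proj2 uA k; rewrite !mxE mulrC => <-.
by apply: eq_bigr => j _; rewrite mxE.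
Qed.

Lemma eigenbasis_dotp x y :
  dotp x (A *m y) = \sum_(k < n) eigval A k * (dotp x (u k) * dotp y (u k)).
Proof.
rewrite [in LHS]eigenbasis_odiag odiag_dotp; apply: eq_bigr => k _.
by rewrite !U_tr_mul mxE.
Qed.

Lemma eigenbasis_parseval x : dotp x x = \sum_k dotp x (u k) ^+ 2.
Proof.
by rewrite (orthogonal_dotp UU); apply: eq_bigr => k _; rewrite U_tr_mul expr2.
Qed.

Lemma eigval_spectral_norm (k : 'I_n) : eigval A k <= spectral_norm A.
Proof.
have e1 l : enorm (u l) = 1 by rewrite /enorm (proj1 uA) eqxx sqrtr1.
apply: (@le_trans _ _ (enorm (A *m u k))).
  rewrite (proj2 uA) /enorm dotpZl dotpZr (proj1 uA) eqxx mulr1 -expr2.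
  by rewrite sqrtr_sqr ler_norm.
apply: ub_le_sup; last by exists (u k) => //=; rewrite e1.
(* A supremum bounds its set only if the set is bounded above; the Frobenius norm serves as the
   bound. *)
exists (Num.sqrt (\sum_(l < n) eigval A l ^+ 2)) => _ [x /= x1 <-].
rewrite /enorm ler_wsqrtr// eigenbasis_parseval; apply: ler_sum => l _.
have -> : dotp (A *m x) (u l) = eigval A l * dotp x (u l).
  rewrite dotpC eigenbasis_dotp (bigD1 l)//= big1 => [|i il].
    by rewrite (proj1 uA) eqxx mul1r addr0.
  by rewrite (proj1 uA) eq_sym (negbTE il) mul0r mulr0.
rewrite exprMn -[leRHS]mulr1 ler_wpM2l ?sqr_ge0//.
apply: le_trans (dotp_CauchySchwarz x (u l)) _.
rewrite (proj1 uA) eqxx mulr1 -enorm_sqr -[leRHS](expr1n _ 2).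
by apply: lerXn2r => //; rewrite nnegrE ?ler01// sqrtr_ge0.
Qed.

Lemma dotp_spectral_norm x : dotp x (A *m x) <= spectral_norm A * dotp x x.
Proof.
rewrite eigenbasis_dotp eigenbasis_parseval mulr_sumr; apply: ler_sum => k _.
by rewrite -expr2 ler_wpM2r ?sqr_ge0// eigval_spectral_norm.
Qed.

Lemma psd_eigval_ge0 (k : 'I_n) : psd A -> 0 <= eigval A k.
Proof.
move=> [_ /(_ (u k))].
by rewrite (proj2 uA) dotpZr (proj1 uA) eqxx mulr1.
Qed.

(* The indices [k < M], and those with eigenvalue above [th], of which there
   are at most [M + nu / th], contribute at most [c ^+ 2] each. *)
Lemma dotp_invmx_shift_ge (m s th c nu : R) (M : nat) (x : 'cV[R]_n) :
  psd A -> 0 <= m -> 0 < s -> 0 < th -> m * th <= s -> (M <= n)%N ->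
  \sum_(M <= k < n) eigval A k <= nu ->
  (forall k, `|dotp x (u k)| <= c) ->
  (dotp x x - c ^+ 2 * (M%:R + nu / th)) / (2 * s) <=
  dotp x (invmx (m *: A + s%:M) *m x).
Proof.
move=> pA m0 s0 th0 mth Mn Anu xc.
have l0 (k : 'I_n) := psd_eigval_ge0 k pA.
pose d : 'rV[R]_n := \row_k (m * eigval A k + s).
have d0 k : 0 < d 0 k by rewrite mxE ltr_wpDl// mulr_ge0.
have AE : m *: A + s%:M = odiag U d.
  rewrite [in LHS]eigenbasis_odiag odiagZ (odiag_const UU) odiagD.
  by congr odiag; apply/rowP => k; rewrite !mxE.
have -> : invmx (m *: A + s%:M) = odiag U (\row_k (d 0 k)^-1).
  rewrite AE; have pd : posdef (odiag U d) by apply/(odiag_posdef UU).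
  apply: (can_inj (mulKmx (posdef_unitmx pd))).
  rewrite mulmxV ?posdef_unitmx// odiag_mul// (odiag_const UU); congr odiag.
  by apply/rowP => k; rewrite [LHS]mxE [RHS]mxE [X in _ * X]mxE mulfV// gt_eqF.
rewrite odiag_dotp.
(* As in Markov's inequality: [w k >= 1] on each index given up, so the total of the [w k] bounds
   their number. *)
pose w k : R := if (k < M)%N then 1 else eigval A k / th.
have wsum : \sum_(k < n) w k <= M%:R + nu / th.
  rewrite -(big_mkord xpredT w) (big_cat_nat (leq0n M) Mn)/=; apply: lerD.
    rewrite big_mkord (eq_bigr (fun=> 1)) => [|k _]; last by rewrite /w ltn_ord.
    by rewrite sumr_const card_ord.
  rewrite big_nat_cond (eq_bigr (fun k => eigval A k / th)) => [|k]; last first.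
    by move=> /andP[/andP[Mk _] _]; rewrite /w ltnNge Mk.
  by rewrite -big_nat_cond -mulr_suml ler_wpM2r// invr_ge0 ltW.
apply: (@le_trans _ _ (\sum_k (dotp x (u k) ^+ 2 - c ^+ 2 * w k) / (2 * s))).
  rewrite -mulr_suml; apply: ler_wpM2r; first by rewrite invr_ge0 mulr_ge0// ltW.
  rewrite sumrB -eigenbasis_parseval -mulr_sumr lerD2l lerN2.
  by rewrite ler_wpM2l ?sqr_ge0.
apply: ler_sum => k _; rewrite U_tr_mul -expr2 mxE.
have xk0 := sqr_ge0 (dotp x (u k)).
have xk : dotp x (u k) ^+ 2 <= c ^+ 2.
  by rewrite -real_normK ?num_real// lerXn2r ?nnegrE// (le_trans _ (xc k)).
have dV : 0 <= (d 0 k)^-1 by rewrite invr_ge0 ltW.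
have s2 : 0 < 2 * s by lra.
(* On an index given up the left-hand summand is at most [0], by the bound [c] on the coordinate.
   Elsewhere the eigenvalue is below [th], so the denominator [m * eigval + s] is at most
   [2 * s]. *)
have [wk|wk] := leP 1 (w k).
  apply: (@le_trans _ _ 0); last exact: mulr_ge0.
  by rewrite pmulr_lle0 ?invr_gt0//; have := sqr_ge0 c; nra.
have w0 : 0 <= w k.
  by rewrite /w; case: ifP => // _; rewrite divr_ge0// ltW.
have dk : d 0 k <= 2 * s.
  rewrite mxE; move: wk; rewrite /w; case: ifP => _; first by rewrite ltxx.
  by rewrite ltr_pdivrMr// mul1r => wk; have := l0 k; nra.
rewrite mulrC; apply: (@le_trans _ _ ((2 * s)^-1 * dotp x (u k) ^+ 2)).
  by rewrite ler_wpM2l ?invr_ge0 ?(ltW s2)//; have := sqr_ge0 c; nra.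
by rewrite ler_wpM2r// lef_pV2// posrE.
Qed.

End eigenbasis.

(** * The forward process *)

Section noise_schedule.
Context {R : realType}.
Implicit Types s t c : R.

Lemma scale_m_gt0 t : 0 < scale_m t. Proof. exact: expR_gt0. Qed.

Lemma scale_m_sqr t : scale_m t ^+ 2 = expR (- (2 * t)).
Proof. by rewrite -expRM_natl mulrN. Qed.

Lemma scale_m_sqr_lt1 t : 0 < t -> scale_m t ^+ 2 < 1.
Proof. by move=> t0; rewrite scale_m_sqr expR_lt1 oppr_lt0 mulr_gt0. Qed.

Lemma scale_sigma_sqr t : 0 < t -> scale_sigma t ^+ 2 = 1 - scale_m t ^+ 2.
Proof.
by move=> t0; rewrite sqr_sqrtr// subr_ge0 ltW// scale_m_sqr_lt1.
Qed.

Lemma scale_sigma_sqr_gt0 t : 0 < t -> 0 < scale_sigma t ^+ 2.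
Proof. by move=> t0; rewrite scale_sigma_sqr// subr_gt0 scale_m_sqr_lt1. Qed.

Lemma SNR_gt0 t : 0 < t -> 0 < SNR t.
Proof.
by move=> t0; rewrite divr_gt0 ?scale_sigma_sqr_gt0// exprn_gt0 ?scale_m_gt0.
Qed.

(** [c <= m^2 / (1 - m^2)] amounts to [c / (1 + c) <= m^2 = exp (- 2 t)]; this is where the
    logarithmic endpoint of the time window comes from. *)
Lemma le_SNR t c : 0 < t -> 0 < c -> (c <= SNR t) = (t <= - (ln (c / (1 + c)) / 2)).
Proof.
move=> t0 c0; have c1 : 0 < 1 + c by lra.
rewrite /SNR ler_pdivlMr ?scale_sigma_sqr_gt0// scale_sigma_sqr//.
have -> : (c * (1 - scale_m t ^+ 2) <= scale_m t ^+ 2) =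
    (c / (1 + c) <= scale_m t ^+ 2).
  by rewrite ler_pdivrMr//; apply/idP/idP; lra.
rewrite -[c / _]lnK ?posrE ?divr_gt0// scale_m_sqr ler_expR expRK.
by apply/idP/idP; lra.
Qed.

Lemma ler_SNR s t : 0 < s -> 0 < t -> (SNR s <= SNR t) = (t <= s).
Proof.
move=> s0 t0; rewrite le_SNR ?SNR_gt0//; congr (_ <= _).
have h : 1 + SNR s = (scale_sigma s ^+ 2)^-1.
  rewrite /SNR -[X in X + _](divff (lt0r_neq0 (scale_sigma_sqr_gt0 s0))) -mulrDl.
  by rewrite [X in X + _]scale_sigma_sqr// subrK mul1r.
rewrite h invrK /SNR divfK ?lt0r_neq0 ?scale_sigma_sqr_gt0//.
by rewrite scale_m_sqr expRK; field.
Qed.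

Lemma time_window (T t eps c : R) : 0 <= t < T -> 0 < eps -> 0 < c ->
  (Num.max 0 (T + ln (c / (1 + c)) / 2) <= t <= T - eps) =
  (Num.max (SNR T) c <= SNR (T - t) <= SNR eps).
Proof.
move=> /andP[t0 tT] e0 c0; have s0 : 0 < T - t by rewrite subr_gt0.
have T0 : 0 < T by lra.
rewrite !ge_max !ler_SNR// le_SNR// t0 /= (_ : T - t <= T); last by lra.
by congr (_ && _); apply/idP/idP; lra.
Qed.

End noise_schedule.

Section forward_law.
Context {R : realType} {K D : nat}.
Variable G : @gmm R K D.
Implicit Types (t : R) (i j k : 'I_K).

Lemma fwd_cov_dotp t k x : dotp x (fwd_cov G t k *m x) =
  scale_m t ^+ 2 * dotp x (cov G k *m x) + scale_sigma t ^+ 2 * dotp x x.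
Proof.
by rewrite mulmxDl -scalemxAl mul_scalar_mx dotpDr !dotpZr.
Qed.

Lemma fwd_cov_ge t k x :
  scale_sigma t ^+ 2 * dotp x x <= dotp x (fwd_cov G t k *m x).
Proof.
rewrite fwd_cov_dotp lerDr mulr_ge0 ?sqr_ge0//.
by have [_] := cov_psd G k; apply.
Qed.

Lemma fwd_cov_posdef t k : 0 < t -> posdef (fwd_cov G t k).
Proof.
move=> t0; split.
  by rewrite linearD linearZ /= tr_scalar_mx; have [->] := cov_psd G k.
move=> x x0; apply: lt_le_trans (fwd_cov_ge t k x).
by rewrite mulr_gt0 ?scale_sigma_sqr_gt0// dotp_gt0.
Qed.

Lemma fwd_pdf_gt0 t k x : 0 < t -> 0 < fwd_pdf G t k x.
Proof. by move=> t0; apply/gaussian_pdf_gt0/fwd_cov_posdef. Qed.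

Lemma fwd_law_probability t k : exists Q : probability 'cV[R]_D R,
  fwd_law G t k = Q :> (set 'cV[R]_D -> \bar R).
Proof.
exact: (pushforward_probability (@std_gaussian R D) (measurable_gaussian_map _ _)).
Qed.

Lemma KL_fwd_self t j : 0 < t -> KL_fwd G t j j = 0%E.
Proof.
move=> t0; rewrite /KL_fwd /KL; have [Q ->] := fwd_law_probability t j.
by apply: integral0_eq => x _; rewrite divff ?ln1// gt_eqF// fwd_pdf_gt0.
Qed.

(** The covariance of cluster [j] is at most [m^2 Lam + sigma^2] and that of cluster [i] at least
    [sigma^2]; their ratio is [1 + SNR Lam]. Returning the divergence as a real [kl] records its
    finiteness. *)
Lemma fwd_deviation t j i (Lam eta : R) : 0 < t -> 0 <= Lam ->
  (forall x, dotp x (cov G j *m x) <= Lam * dotp x x) -> 0 < eta < 1 ->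
  exists kl : R, [/\ KL_fwd G t j i = kl%:E,
    scale_m t ^+ 2 / 2 * dotp (mean G j - mean G i)
      (invmx (fwd_cov G t i) *m (mean G j - mean G i)) <= kl &
    forall c, (fwd_law G t j
      [set x | ln (fwd_pdf G t j x / fwd_pdf G t i x) <= eta * kl + c]%R <=
      (expR (- ((1 - eta) / 2 / (1 + SNR t * Lam) *
        ((1 - eta) / 2 * kl - c))))%:E)%E].
Proof.
move=> t0 L0 covL eta01.
have pj := fwd_cov_posdef j t0; have pi' := fwd_cov_posdef i t0.
have s0 := scale_sigma_sqr_gt0 t0.
exists (wkl (whiten_mx (fwd_cov G t j) (fwd_cov G t i))
  (whiten_mean (fwd_mean G t j) (fwd_mean G t i) (fwd_cov G t j))); split.
- exact: gaussian_KL.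
- apply: le_trans (wkl_whiten_ge _ _ pj pi').
  rewrite /fwd_mean -scalerBr -scalemxAr dotpZl dotpZr le_eqVlt; apply/orP; left.
  by apply/eqP; field.
move=> c; under eq_set do rewrite ln_gaussian_pdf_ratio//.
have -> : 1 + SNR t * Lam =
    (scale_m t ^+ 2 * Lam + scale_sigma t ^+ 2) / scale_sigma t ^+ 2.
  by rewrite /SNR mulrDl divff ?gt_eqF// addrC mulrAC.
apply: gaussian_llr_chernoff => //.
- by rewrite lerDr mulr_ge0 ?sqr_ge0.
- by move=> x; exact: fwd_cov_ge.
move=> x; rewrite fwd_cov_dotp mulrDl lerD2r -mulrA.
by rewrite ler_wpM2l ?sqr_ge0.
Qed.

End forward_law.

(** * Concentration of the posterior weights *)

Lemma measure_union_bound {R : realType} d (T : measurableType d)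
    (P : probability T R) (I : finType) (p : pred I) (B : I -> set T) (e : R) :
  0 <= e -> (forall i, p i -> measurable (B i)) ->
  (forall i, p i -> (P (B i) <= e%:E)%E) ->
  (P (\big[setU/set0]_(i | p i) B i) <= (#|I|%:R * e)%:E)%E.
Proof.
move=> e0 mB Be.
apply: (@le_trans _ _ (\sum_(i | p i) e)%:E); last first.
  rewrite lee_fin mulr_natl -sumr_const big_mkcond; apply: ler_sum => i _.
  by case: ifP.
suff [] : measurable (\big[setU/set0]_(i | p i) B i) /\
    (P (\big[setU/set0]_(i | p i) B i) <= (\sum_(i | p i) e)%:E)%E by [].
apply: (big_ind2 (fun A x => measurable A /\ (P A <= x%:E)%E)).
- by rewrite measure0.
- move=> A x A' x' [mA Ax] [mA' Ax']; split; first exact: measurableU.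
  have H := @measureU2 _ _ _ P _ _ mA mA'.
  by apply: le_trans H _; rewrite EFinD leeD.
- by move=> i pi'; split; [exact: mB | exact: Be].
Qed.

Section posterior.
Context {R : realType} {K D : nat}.
Variable G : @gmm R K D.
Implicit Types (t : R) (i j k : 'I_K).
Hypothesis w_gt0 : forall k, 0 < weight G k.

Lemma post_weight_denom_gt0 T t x : t < T -> (0 < K)%N ->
  0 < \sum_l weight G l * fwd_pdf G (T - t) l x.
Proof.
move=> tT K0; have s0 : 0 < T - t by rewrite subr_gt0.
have p0 l : 0 < weight G l * fwd_pdf G (T - t) l x by rewrite mulr_gt0 ?fwd_pdf_gt0.
rewrite (bigD1 (Ordinal K0))//= ltr_wpDr// sumr_ge0// => l _; exact: ltW.
Qed.

Lemma measurable_post_weight_le T t k (c : R) : t < T ->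
  measurable [set x | post_weight G T t k x <= c].
Proof.
move=> tT; have K0 : (0 < K)%N by case: (k) => m; exact: leq_ltn_trans.
have mp l : measurable_fun setT (fun x => weight G l * fwd_pdf G (T - t) l x).
  by apply: measurable_funM => //; exact: measurable_gaussian_pdf.
have -> : [set x | post_weight G T t k x <= c] =
    setT `&` [set x | weight G k * fwd_pdf G (T - t) k x <=
      c * \sum_l weight G l * fwd_pdf G (T - t) l x].
  rewrite setTI; apply/seteqP; split => x /=;
    by rewrite /post_weight ler_pdivrMr ?post_weight_denom_gt0.
apply: measurable_fun_le => //; apply: measurable_funM => //.
exact: measurable_sum.
Qed.

(** Of the mixture density in the denominator only the term of cluster [j] is kept. *)
Lemma post_weight_le T t j k x : t < T ->
  post_weight G T t k x <= expR (ln (weight G k / weight G j) -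
    ln (fwd_pdf G (T - t) j x / fwd_pdf G (T - t) k x)).
Proof.
move=> tT; have s0 : 0 < T - t by rewrite subr_gt0.
have p0 l : 0 < fwd_pdf G (T - t) l x by exact: fwd_pdf_gt0.
have wp0 l : 0 < weight G l * fwd_pdf G (T - t) l x by rewrite mulr_gt0.
rewrite expRB !lnK ?posrE ?divr_gt0// invf_div mulrACA -invfM.
rewrite /post_weight ler_pM2l// lef_pV2 ?posrE//; last first.
  by rewrite (bigD1 j)//= ltr_wpDr// sumr_ge0// => l _; exact: ltW.
by rewrite [leRHS](bigD1 j)//= lerDl sumr_ge0// => l _; exact: ltW.
Qed.

(** [rev_law] factors the joint probability into the weight of [j] and the forward law, and the
    positive weight cancels in the conditional probability. *)
Lemma reverse_process_prob T t d (Omega : measurableType d)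
    (P : probability Omega R) (X : reverse_process G T P) j
    (A : set 'cV[R]_D) (del : R) :
  0 <= t <= T -> measurable A -> (fwd_law G (T - t) j (~` A) <= del%:E)%E ->
  1 - del <= cond_prob P [set w | A (rev_state X t w)] [set w | label X w = j].
Proof.
move=> tT mA; rewrite /cond_prob label_law.
rewrite -[[set w | A _]]/(rev_state X t @^-1` A) rev_law//.
have [Q ->] := fwd_law_probability G (T - t) j.
rewrite probability_setC// => QA.
rewrite fineM ?fin_num_measure//= mulrC mulKf ?gt_eqF//.
rewrite -lee_fin fineK ?fin_num_measure// EFinB.
by rewrite leeBlDr// addeC -leeBlDr ?fin_num_measure.
Qed.

End posterior.

(** * Uniform constants and asymptotics in the dimension *)

Lemma finite_pos_lower_bound {R : realType} (I : finType) (P : I -> R -> Prop) :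
  (forall i, exists2 c, 0 < c & P i c) ->
  (forall i c c', P i c -> c' <= c -> P i c') ->
  exists2 c, 0 < c & forall i, P i c.
Proof.
move=> Pex Pdec.
have Pex' i : exists c, 0 < c /\ P i c by have [c] := Pex i; exists c.
have [f fP] := choice Pex'.
have f0 i : 0 < (f i)^-1 by rewrite invr_gt0; have [] := fP i.
have s0 : 0 < 1 + \sum_i (f i)^-1.
  by rewrite ltr_pwDl// sumr_ge0// => i _; exact: ltW.
(* A positive number below every [f i], in place of a minimum, which also covers an empty [I]. *)
exists (1 + \sum_i (f i)^-1)^-1; first by rewrite invr_gt0.
move=> i; have [fi Pi] := fP i; apply: (Pdec _ _ _ Pi).
rewrite -[leRHS]invrK lef_pV2 ?posrE// (bigD1 i)//= addrCA lerDl addr_ge0//.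
by rewrite sumr_ge0// => k _; exact: ltW.
Qed.

Lemma eventually_forall (I : finType) (P : I -> nat -> Prop) :
  (forall i, exists N : nat, forall D, (N <= D)%N -> P i D) ->
  exists N : nat, forall D, (N <= D)%N -> forall i, P i D.
Proof.
move=> Pex; have [f fP] := choice Pex.
exists (\max_i f i) => D ND i; apply: fP; apply: leq_trans ND.
exact: leq_bigmax.
Qed.

Lemma exists_nat_ge {R : realType} (x : R) : exists N : nat, forall D,
  (N <= D)%N -> x <= D%:R.
Proof.
exists (Num.bound `|x|) => D ND; apply: le_trans (ler_norm x) _.
by apply: le_trans (ltW (archi_boundP (normr_ge0 x))) _; rewrite ler_nat.
Qed.

(** With [b = a / 2], [ln x = ln (x^b) / b <= x^b / b]; one factor [D^b] comes from this bound and
    the other absorbs the constants once [D] is large. *)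
Lemma eventually_ln_le {R : realType} (K : nat) (a kap : R) : 0 < a ->
  (0 < K)%N -> exists N : nat, forall D, (N <= D)%N -> (0 < D)%N ->
  kap * ln (K * D)%:R <= D%:R `^ a.
Proof.
move=> a0 K0; pose b := a / 2; have b0 : 0 < b by rewrite divr_gt0.
pose y := `|kap| * K%:R `^ b / b.
have y0 : 0 <= y by rewrite divr_ge0 ?mulr_ge0 ?powR_ge0// ltW.
have [N NP] := exists_nat_ge (y `^ b^-1).
exists N => D /NP ND D0.
have yD : y <= D%:R `^ b.
  have -> : y = (y `^ b^-1) `^ b by rewrite -powRrM mulVf ?lt0r_neq0// powRr1.
  apply: ge0_ler_powR => //; rewrite ?nnegrE ?powR_ge0 ?ler0n//.
  exact: ltW.
have x0 : 0 < (K * D)%:R :> R by rewrite ltr0n muln_gt0 K0.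
have lnx : ln (K * D)%:R <= K%:R `^ b * D%:R `^ b / b.
  rewrite ler_pdivlMr// mulrC -ln_powR -powRM ?ler0n// -natrM.
  by rewrite ltW// ln_sublinear// powR_gt0.
have ln0 : 0 <= ln (K * D)%:R :> R by rewrite ln_ge0// ler1n muln_gt0 K0.
apply: (@le_trans _ _ (`|kap| * ln (K * D)%:R)).
  by rewrite ler_wpM2r// ler_norm.
apply: (@le_trans _ _ (`|kap| * (K%:R `^ b * D%:R `^ b / b))).
  by rewrite ler_wpM2l.
rewrite (_ : `|kap| * _ = y * D%:R `^ b); last by rewrite /y; field; rewrite gt_eqF.
rewrite (_ : a = b + b); last by rewrite /b; field.
rewrite powRD; last by rewrite pnatr_eq0 -lt0n D0 implybT.
by rewrite ler_wpM2r// powR_ge0.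
Qed.

(** Here [s] stands for the signal-to-noise ratio, [n] for the dimension and [ell] for [ln (K D)].
    By the first bound half of [tau c0 s n] pays for [C1]. The remaining [tau^2 c0 s n / 2] is split
    again: the second bound pays for [q ell], and the third, multiplied by [s], for
    [q ell s Lam]. *)
Lemma exponent_ge {R : realType} (tau c0 C1 q ell s n Lam : R) :
  0 < tau -> 0 < c0 -> 0 <= s -> 0 <= Lam ->
  2 * C1 <= tau * c0 * (s * n) ->
  4 * q * ell <= tau ^+ 2 * c0 * (s * n) ->
  4 * q * ell * Lam <= tau ^+ 2 * c0 * n ->
  q * ell <= tau / (1 + s * Lam) * (tau * (c0 * s * n) - C1).
Proof.
move=> tau0 c00 s0 L0 h1 h2 h3.
have d0 : 0 < 1 + s * Lam by rewrite ltr_pwDl// mulr_ge0.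
rewrite mulrAC ler_pdivlMr//.
have h4 : s * (4 * q * ell * Lam) <= s * (tau ^+ 2 * c0 * n) by rewrite ler_wpM2l.
have h5 : tau * (2 * C1) <= tau * (tau * c0 * (s * n)) by rewrite ler_pM2l.
nra.
Qed.

Section mean_separation.
Context {R : realType} {K : nat}.
Variable G : forall D, @gmm R K D.
Hypotheses (A2 : assumption2_trace G) (A3 : assumption3 G) (A4 : assumption4 G).

(** [c] precedes [eps], which only fixes the eigenvalue threshold [1 / SNR eps] and, through it,
    [N]. Since [SNR t <= SNR eps], an eigenvalue below that threshold contributes at most [sigma^2]
    to the forward covariance. *)
Lemma mean_term_ge (i j : 'I_K) : i != j -> exists2 c : R, 0 < c &
  forall eps : R, 0 < eps -> exists N : nat, forall D, (N <= D)%N ->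
  forall t, eps <= t ->
  c * SNR t * D%:R <= scale_m t ^+ 2 / 2 *
    dotp (mean (G D) j - mean (G D) i)
      (invmx (fwd_cov (G D) t i) *m (mean (G D) j - mean (G D) i)).
Proof.
move=> ij; have ji : j != i by rewrite eq_sym.
have [C3 [C4 [C3_0 _ hC3]]] := A3 ji.
have [C5 C5_0 hC5] := A4.
have [r _ /(_ i)[M [nu [M0 nu0 _ hnu]]]] := A2.
(* One factor 1/2 is the share of the squared distance left after giving up coordinates, one comes
   from the bound [2 * sigma^2] on the kept eigenvalues, and one from the divergence itself. *)
exists (C3 / 8); first by rewrite divr_gt0.
move=> eps eps0; have Se := SNR_gt0 eps0.
(* From this dimension on, the coordinates given up account for at most [C3 D / 2]. *)
have [N NP] := exists_nat_ge (2 * (C5 ^+ 2 * (M%:R + nu * SNR eps)) / C3).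
exists (maxn M.+1 N) => D; rewrite geq_max => /andP[MD /NP ND] t et.
have D0 : (0 < D)%N by exact: leq_ltn_trans MD.
have t0 : 0 < t by exact: lt_le_trans et.
have [u uA uC] := hC5 _ D0 i.
set x := mean (G D) j - mean (G D) i.
have s0 := scale_sigma_sqr_gt0 t0.
have mth : scale_m t ^+ 2 * (SNR eps)^-1 <= scale_sigma t ^+ 2.
  rewrite ler_pdivrMr// mulrC -ler_pdivrMr// -/(SNR t).
  by rewrite ler_SNR.
have thV : 0 < (SNR eps)^-1 by rewrite invr_gt0.
have := dotp_invmx_shift_ge uA (cov_psd (G D) i) (sqr_ge0 (scale_m t)) s0 thV
  mth (ltnW MD) (hnu _ MD) (uC j).
rewrite invrK -/x -/(fwd_cov (G D) t i); set q := dotp x (_ *m x) => hq.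
have /andP[hx _] := hC3 _ D0; rewrite enorm_sqr -/x in hx.
rewrite ler_pdivrMr// in ND.
apply: (@le_trans _ _ (scale_m t ^+ 2 / 2 *
   (C3 * D%:R / 2 / (2 * scale_sigma t ^+ 2)))).
  rewrite /SNR le_eqVlt; apply/orP; left; apply/eqP.
  move: (scale_sigma t ^+ 2) s0 => s s0; move: (scale_m t ^+ 2) => m.
  by field; rewrite gt_eqF.
apply: ler_wpM2l; first by rewrite mulr_ge0 ?sqr_ge0.
apply: le_trans hq; rewrite ler_pM2r; last by rewrite invr_gt0; exact: mulr_gt0.
by lra.
Qed.

Lemma mean_terms_ge : exists2 c : R, 0 < c &
  forall eps : R, 0 < eps -> exists N : nat, forall D, (N <= D)%N ->
  forall i j : 'I_K, i != j -> forall t, eps <= t ->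
  c * SNR t * D%:R <= scale_m t ^+ 2 / 2 *
    dotp (mean (G D) j - mean (G D) i)
      (invmx (fwd_cov (G D) t i) *m (mean (G D) j - mean (G D) i)).
Proof.
pose B (p : 'I_K * 'I_K) (c eps : R) (D : nat) := p.1 != p.2 ->
  forall t, eps <= t ->
  c * SNR t * D%:R <= scale_m t ^+ 2 / 2 *
    dotp (mean (G D) p.2 - mean (G D) p.1)
      (invmx (fwd_cov (G D) t p.1) *m (mean (G D) p.2 - mean (G D) p.1)).
pose Q p c := forall eps : R, 0 < eps -> exists N : nat,
  forall D, (N <= D)%N -> B p c eps D.
have Qex p : exists2 c, 0 < c & Q p c.
  have [p12|p12] := eqVneq p.1 p.2.
    by exists 1 => // eps _; exists 0%N => D _; rewrite /B p12 eqxx.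
  have [c c0 cP] := mean_term_ge p12.
  by exists c => // eps /cP[N NP]; exists N => D ND _; exact: NP.
have Qdec p c c' : Q p c -> c' <= c -> Q p c'.
  move=> Qc cc eps eps0; have [N NP] := Qc _ eps0.
  exists N => D ND p12 t et; apply: le_trans (NP D ND p12 t et).
  rewrite ler_wpM2r ?ler0n// ler_wpM2r// ltW// SNR_gt0//.
  exact: lt_le_trans et.
have [c c0 cP] := finite_pos_lower_bound Qex Qdec.
exists c => // eps eps0.
have [N NP] := eventually_forall (fun p => cP p eps eps0).
by exists N => D ND i j ij; have := NP D ND (i, j); apply.
Qed.

End mean_separation.

Section concentration.
Context {R : realType} {K D : nat}.
Variable G : @gmm R K D.
Hypothesis w_gt0 : forall k, 0 < weight G k.

(** The thresholds [c] are left free so that one estimate serves both claims: [exp (- eta kl)]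
    itself for the first, a constant [beta] off the label for the second. The factor [K] in the
    failure probability comes from the union over the clusters. *)
Lemma posterior_concentration (T t C1 Lam eta lb del : R) d
    (Omega : measurableType d) (P : probability Omega R)
    (X : reverse_process G T P) (j : 'I_K) :
  0 <= t < T -> (forall i k, ln (weight G i / weight G k) <= C1) ->
  0 <= Lam -> (forall x, dotp x (cov G j *m x) <= Lam * dotp x x) ->
  0 < eta < 1 -> 0 <= C1 <= (1 - eta) / 2 * lb ->
  (forall i, i != j -> lb <= scale_m (T - t) ^+ 2 / 2 *
    dotp (mean G j - mean G i)
      (invmx (fwd_cov G (T - t) i) *m (mean G j - mean G i))) ->
  K%:R * expR (- ((1 - eta) / 2 / (1 + SNR (T - t) * Lam) *
    ((1 - eta) / 2 * lb - C1))) <= del ->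
  exists kl : 'I_K -> R, [/\ forall i, KL_fwd G (T - t) j i = (kl i)%:E,
    forall i, i != j -> lb <= kl i &
    forall c : 'I_K -> R, (forall i, expR (- (eta * kl i)) <= c i) ->
      1 - del <= cond_prob P
        [set w | forall i, post_weight G T t i (rev_state X t w) <= c i]
        [set w | label X w = j]].
Proof.
move=> /andP[t0 tT] hC1 L0 covL eta01 /andP[C10 C1lb] hlb hdel.
have s0 : 0 < T - t by rewrite subr_gt0.
have [kl klP] := choice (fun i => fwd_deviation i s0 L0 covL eta01).
have kllb i : i != j -> lb <= kl i.
  by move=> ij; apply: le_trans (hlb i ij) _; have [] := klP i.
have klj : kl j = 0.
  have [E _ _] := klP j; move: E; rewrite KL_fwd_self//.
  by move=> [].
exists kl; split=> //; first by move=> i; have [] := klP i.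
move=> c hc.
pose A := [set x | forall i, post_weight G T t i x <= c i].
have mA : measurable A.
  have -> : A = \bigcap_(i in [set: 'I_K]) [set x | post_weight G T t i x <= c i].
    by apply/seteqP; split => [x h i _|x h i]; [exact: h | exact: (h i)].
  apply: fin_bigcap_measurable => // i _; exact: measurable_post_weight_le.
have tT' : 0 <= t <= T by rewrite t0 ltW.
apply: (reverse_process_prob w_gt0 X tT' mA).
apply: (@le_trans _ _ (K%:R * expR (- ((1 - eta) / 2 / (1 + SNR (T - t) * Lam) *
    ((1 - eta) / 2 * lb - C1))))%:E); last by rewrite lee_fin.
(* The offset [C1] pays for the ratio of the prior weights. *)
pose B i := [set x | ln (fwd_pdf G (T - t) j x / fwd_pdf G (T - t) i x) <=
  eta * kl i + C1].
have mB i : measurable (B i).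
  rewrite -[X in measurable X]setTI; apply: measurable_fun_le => //.
  have -> : (fun x => ln (fwd_pdf G (T - t) j x / fwd_pdf G (T - t) i x)) =
      gllr (fwd_mean G (T - t) j) (fwd_mean G (T - t) i)
        (fwd_cov G (T - t) j) (fwd_cov G (T - t) i).
    by apply/funext => x; apply: ln_gaussian_pdf_ratio; exact: fwd_cov_posdef.
  exact: measurable_gllr.
(* The index [j] never causes a failure: its divergence is [0], so its threshold is at least [1],
   and its posterior weight is at most [1]. *)
have AB : ~` A `<=` \big[setU/set0]_(i | i != j) B i.
  move=> x Ax; rewrite -bigcup_seq_cond/=; apply: contrapT => nB; apply: Ax => i.
  apply: le_trans (hc i); apply: le_trans (post_weight_le w_gt0 j i x tT) _.
  rewrite ler_expR; have [->|ij] := eqVneq i j.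
    by rewrite klj mulr0 oppr0 !divff ?ln1 ?subrr// gt_eqF// fwd_pdf_gt0.
  have : ~ B i x by move=> Bx; apply: nB; exists i => //=; rewrite mem_index_enum.
  move=> /negP; rewrite -ltNge => h; have := hC1 i j; lra.
have [Q QE] := fwd_law_probability G (T - t) j.
rewrite QE; apply: (@le_trans _ _ (Q (\big[setU/set0]_(i | i != j) B i))).
  apply: le_measure => //; rewrite inE; first exact: measurableC.
  exact: bigsetU_measurable.
rewrite -[X in (X%:R * _)%:E]card_ord; apply: measure_union_bound => // i ij.
rewrite -QE; have [_ _ /(_ C1)] := klP i; move=> /le_trans; apply.
rewrite lee_fin ler_expR lerN2; apply: ler_wpM2l.
  have := SNR_gt0 s0; move: eta01 => /andP[_ e1] S0.
  by rewrite divr_ge0//; [lra | rewrite addr_ge0// mulr_ge0// ltW].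
by move: eta01 => /andP[_ e1]; have := kllb i ij; nra.
Qed.

End concentration.

(** * Choice of the constants and assembly *)

Theorem theorem1 (R : realType) (K : nat) (hK : (2 <= K)%N)
    (G : forall D : nat, @gmm R K D)
    (A1 : assumption1 G) (A2 : assumption2 G)
    (A3 : assumption3 G) (A4 : assumption4 G)
    (eta q : R) (heta : 0 < eta < 1) (hq : 2 <= q) :
  exists (S : nat -> R) (L : R),
    [/\ Theta S (fun D => ln ((K * D)%:R) / D%:R), 0 < L &
    forall eps : R, 0 < eps < 1 -> exists Ddag : nat,
    forall D : nat, (Ddag <= D)%N -> forall T : R, 1 <= T ->
    (forall t : R, 0 <= t < T ->
      (Num.max 0 (T + ln (S D / (1 + S D)) / 2) <= t <= T - eps) =
      (Num.max (SNR T) (S D) <= SNR (T - t) <= SNR eps)) /\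
    forall (d : measure_display) (Omega : measurableType d)
      (P : probability Omega R) (X : reverse_process (G D) T P) (j : 'I_K),
      (forall t : R,
        Num.max 0 (T + ln (S D / (1 + S D)) / 2) <= t <= T - eps ->
        1 - D%:R `^ (- q) <=
        cond_prob P
          [set w | forall i : 'I_K,
            ((post_weight (G D) T t i (rev_state X t w))%:E <=
             expeR (- (eta%:E * KL_fwd (G D) (T - t) j i)))%E]
          [set w | label X w = j]) /\
      (forall beta t : R, 0 < beta < 1 -> 0 <= t <= T - eps ->
        L * (Num.max (ln ((K * D)%:R)) (ln (1 / beta)) / D%:R)
          <= SNR (T - t) ->
        1 - D%:R `^ (- q) <=
        cond_prob P
          [set w | forall i : 'I_K, i != j ->
            post_weight (G D) T t i (rev_state X t w) <= beta]
          [set w | label X w = j])].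
Proof.
have [C1 C10 hC1] := A1.
have [[C2 [al [C20 /andP[al0 al1] hC2]]] hA2] := A2.
have [c0 c00 hc0] := mean_terms_ge hA2 A3 A4.
have [eta0 eta1] := andP heta.
have K0 : (0 < K)%N by exact: leq_trans hK.
pose tau := (1 - eta) / 2; have tau0 : 0 < tau by rewrite /tau; lra.
have ln2 : 0 < ln 2 :> R by rewrite ln_gt0// ltr1n.
have tc0 : 0 < tau * c0 by rewrite mulr_gt0.
have ttc0 : 0 < tau ^+ 2 * c0 by rewrite mulr_gt0// exprn_gt0.
(* The first term gives [2 C1 <= tau KL], the second [4 q ln (K D) <= tau^2 KL]. *)
pose L1 := 2 * C1 / (tau * c0 * ln 2) + 4 * q / (tau ^+ 2 * c0).
have L1a : 0 <= 2 * C1 / (tau * c0 * ln 2).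
  by apply: divr_ge0; [exact: mulr_ge0 | apply: ltW; exact: mulr_gt0].
have L1b : 0 < 4 * q / (tau ^+ 2 * c0) by rewrite divr_gt0//; lra.
have L10 : 0 < L1 by rewrite ltr_wpDl.
pose ell D : R := ln (K * D)%:R.
(* As [K >= 2], [ln (K D)] stays above [ln 2] even for [D = 1], so a multiple of it can pay for the
   constant [C1]. *)
have ell2 D : (0 < D)%N -> ln 2 <= ell D.
  move=> D0; rewrite ler_ln ?posrE ?ltr0n ?muln_gt0 ?K0// ler_nat.
  by apply: leq_trans hK _; rewrite leq_pmulr.
(* [S] is an exact multiple of the reference rate. In [L], the part [L1] brings the time into the
   regime of the first claim, and [(eta c0)^-1] ensures [eta KL >= ln (1 / beta)]. *)
exists (fun D => L1 * (ell D / D%:R)), (L1 + (eta * c0)^-1); split.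
- by exists L1, L1; split=> // D _; rewrite !lexx.
- by rewrite addr_gt0// invr_gt0 mulr_gt0.
move=> eps /andP[eps0 eps1].
have [N1 hN1] := hc0 _ eps0.
have al10 : 0 < 1 - al by rewrite subr_gt0.
(* The constant is the one for which this gives [4 q ln (K D) Lam <= tau^2 c0 D] with
   [Lam = C2 D^al]; [al < 1] is essential here. *)
have [N2 hN2] := eventually_ln_le (4 * q * C2 / (tau ^+ 2 * c0)) al10 K0.
exists (maxn 1 (maxn N1 N2)) => D; rewrite !geq_max.
move=> /and3P[D0 /hN1 ND1 /hN2 /(_ D0) ND2] T T1.
have Dgt0 : 0 < D%:R :> R by rewrite ltr0n.
have ell0 : 0 < ell D by exact: lt_le_trans (ell2 _ D0).
have S0 : 0 < L1 * (ell D / D%:R) by rewrite mulr_gt0// divr_gt0.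
split=> [t tT|d Omega P X j]; first exact: time_window.
have wpos k : 0 < weight (G D) k by have [] := hC1 D D0 k k.
have core t : 0 <= t <= T - eps -> L1 * (ell D / D%:R) <= SNR (T - t) ->
    exists kl : 'I_K -> R, [/\
      forall i, KL_fwd (G D) (T - t) j i = (kl i)%:E,
      forall i, i != j -> c0 * SNR (T - t) * D%:R <= kl i &
      forall c : 'I_K -> R, (forall i, expR (- (eta * kl i)) <= c i) ->
        1 - D%:R `^ (- q) <= cond_prob P
          [set w | forall i, post_weight (G D) T t i (rev_state X t w) <= c i]
          [set w | label X w = j]].
  move=> /andP[t0 tT] hS.
  have tT' : 0 <= t < T by rewrite t0; lra.
  have s0 : 0 < SNR (T - t) by exact: lt_le_trans hS.
  have [C5 _ /(_ D D0 j)[u uA _]] := A4.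
  pose Lam := C2 * D%:R `^ al.
  have Lam0 : 0 <= Lam by rewrite mulr_ge0 ?powR_ge0// ltW.
  have sn : L1 * ell D <= SNR (T - t) * D%:R.
    by rewrite -ler_pdivrMr// -mulrA.
  have e1 : 2 * C1 <= tau * c0 * (SNR (T - t) * D%:R).
    apply: (@le_trans _ _ (tau * c0 * (L1 * ell D))); last by rewrite ler_pM2l.
    apply: (@le_trans _ _ (tau * c0 * (2 * C1 / (tau * c0 * ln 2) * ln 2))).
      by rewrite le_eqVlt; apply/orP; left; apply/eqP; field; rewrite !gt_eqF.
    rewrite ler_pM2l//; apply: ler_pM; rewrite ?ell2// ?(ltW ln2)//.
    by rewrite lerDl ltW.
  have e2 : 4 * q * ell D <= tau ^+ 2 * c0 * (SNR (T - t) * D%:R).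
    apply: (@le_trans _ _ (tau ^+ 2 * c0 * (L1 * ell D))); last by rewrite ler_pM2l.
    apply: (@le_trans _ _ (tau ^+ 2 * c0 * (4 * q / (tau ^+ 2 * c0) * ell D))).
      by rewrite le_eqVlt; apply/orP; left; apply/eqP; field; rewrite !gt_eqF.
    by rewrite ler_pM2l// ler_pM2r// lerDr.
  have e3 : 4 * q * ell D * Lam <= tau ^+ 2 * c0 * D%:R.
    have -> : D%:R = D%:R `^ (1 - al) * D%:R `^ al :> R.
      by rewrite -powRD ?subrK ?powRr1 ?ler0n// pnatr_eq0 -lt0n D0 implybT.
    rewrite /Lam !mulrA ler_wpM2r ?powR_ge0// -ler_pdivrMl//.
    apply: le_trans ND2; rewrite /ell le_eqVlt; apply/orP; left; apply/eqP.
    by field; rewrite !gt_eqF.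
  apply: (posterior_concentration wpos X (C1 := C1) (Lam := Lam)) => //.
  - by move=> i k; have [] := hC1 D D0 i k.
  - move=> x; apply: le_trans (dotp_spectral_norm uA x) _.
    by rewrite ler_wpM2r ?dotp_ge0 ?hC2.
  - by rewrite C10 -/tau -mulrA mulrA; lra.
  - by move=> i ij; apply: ND1 => //; lra.
  have := exponent_ge tau0 c00 (ltW s0) Lam0 e1 e2 e3; rewrite -/tau.
  move: (tau / _ * _) => ex hex.
  (* Since [q >= 1], the part [q ln K] of [q ln (K D)] absorbs the factor [K] of the union bound and
     leaves [D^(- q)]. *)
  have lnK0 : 0 <= ln K%:R :> R by rewrite ln_ge0// ler1n.
  have KR : 0 < K%:R :> R by rewrite ltr0n.
  rewrite /powR pnatr_eq0 eqn0Ngt D0 /= -[K%:R]lnK ?posrE// -expRD ler_expR.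
  move: hex; rewrite /ell natrM lnM ?posrE//; nra.
split=> [t tw|beta t /andP[b0 b1] tT hL].
  have tT : 0 <= t <= T - eps by move: tw; rewrite ge_max => /andP[/andP[-> _] ->].
  have tT' : 0 <= t < T by move/andP: tT => [-> ?]; lra.
  have hS : L1 * (ell D / D%:R) <= SNR (T - t).
    by move: tw; rewrite time_window// ge_max => /andP[/andP[]].
  have [kl [klE _ /(_ (fun i => expR (- (eta * kl i))))]] := core t tT hS.
  move=> /(_ (fun=> lexx _)); congr (_ <= cond_prob _ _ _).
  by apply/seteqP; split => w h i; have := h i; rewrite klE.
have hS : L1 * (ell D / D%:R) <= SNR (T - t).
  apply: le_trans hL; apply: ler_pM; rewrite ?(ltW L10) ?divr_ge0 ?(ltW ell0)//.
    by rewrite lerDl invr_ge0 mulr_ge0// ltW.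
  by rewrite ler_pM2r ?invr_gt0// le_max lexx.
(* With threshold [1] at the label the condition on [j] always holds, so the event is the
   intersection over [i != j]. *)
have [kl [klE kl_ge /(_ (fun i => if i == j then 1 else beta))]] := core t tT hS.
have s0 : 0 < T - t by move/andP: tT => [_ ?]; lra.
have klj : kl j = 0 by have := klE j; rewrite KL_fwd_self// => -[].
have hc i : expR (- (eta * kl i)) <= if i == j then 1 else beta.
  have [->|ij] := eqVneq i j; first by rewrite klj mulr0 oppr0 expR0.
  rewrite -[beta]lnK ?posrE// ler_expR.
  rewrite lerNl -[- ln beta]lnV ?posrE// -[beta^-1]mul1r.
  apply: (@le_trans _ _ (eta * (c0 * SNR (T - t) * D%:R))); last first.
    by rewrite ler_pM2l// kl_ge.
  have : (eta * c0)^-1 * (ln (1 / beta) / D%:R) <= SNR (T - t).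
    apply: le_trans hL; apply: ler_pM.
    - by rewrite invr_ge0 mulr_ge0// ltW.
    - by rewrite divr_ge0 ?ln_ge0// div1r invf_ge1// ltW.
    - by rewrite lerDr ltW.
    - by rewrite ler_pM2r ?invr_gt0// le_max lexx orbT.
  rewrite [_ * (_ / _)]mulrA ler_pdivrMr// ler_pdivrMl ?mulr_gt0//.
  by rewrite !mulrA.
move=> /(_ hc); congr (_ <= cond_prob _ _ _).
apply/seteqP; split => w h i.
  by move=> ij; have := h i; rewrite (negbTE ij).
have [->|] := eqVneq i j; last exact: h.
have tT' : t < T by rewrite -subr_gt0.
apply: le_trans (post_weight_le wpos j j _ tT') _.
by rewrite !divff ?ln1 ?subrr ?expR0// gt_eqF// fwd_pdf_gt0.
Qed.
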